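(* Let $p\in(0,1)$ and $C\in\mathbb{N}$ with $C\ge 4$ be constants, and let $k=k_0-C$, where $k_0=k_0(n,p)$ is the least integer such that $\binom{n}{k_0}p^{\binom{k_0}{2}}<1$. Then, with probability tending to $1$ as $n\to\infty$, the random graph $G(n,p)$ contains at least \[\frac{p n^2\log n}{40k^4}\] pairwise edge-disjoint $k$-cliques.
   Context: $G(n,p)$ is the Erdős–Rényi random graph on vertex set $\{1,\dots,n\}$ in which each pair is an edge independently with probability $p$. $\log$ denotes the natural logarithm. *)

(* Defs.v *)
From HB Require Import structures.
From mathcomp Require Import all_boot all_order all_algebra.
From mathcomp Require Import all_classical all_reals all_analysis.

Set Implicit Arguments.
Unset Strict Implicit.
Unset Printing Implicit Defensive.

Import Order.TTheory GRing.Theory Num.Theory.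

Local Open Scope ring_scope.

Definition pairs_in (n : nat) (A : {set 'I_n}) : {set {set 'I_n}} :=
  [set e : {set 'I_n} | (e \subset A) && (#|e| == 2)].

(* A simple graph on 'I_n is its edge set, an element of
   [powerset (pairs_in setT)]. *)
Definition gnp_weight (R : realType) (n : nat) (p : R)
    (G : {set {set 'I_n}}) : R :=
  \prod_(e in pairs_in [set: 'I_n]) (if e \in G then p else 1 - p).

Definition gnp_prob (R : realType) (n : nat) (p : R)
    (A : pred {set {set 'I_n}}) : R :=
  \sum_(G in powerset (pairs_in [set: 'I_n]) | A G) gnp_weight p G.

Definition is_clique (n : nat) (G : {set {set 'I_n}}) (k : nat)
    (A : {set 'I_n}) : bool :=
  (#|A| == k) && (pairs_in A \subset G).

Definition edge_disjoint_cliques (n : nat) (G : {set {set 'I_n}}) (k : nat)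
    (F : {set {set 'I_n}}) : bool :=
  [forall A in F, is_clique G k A] &&
  [forall A in F, forall B in F,
     (A != B) ==> [disjoint pairs_in A & pairs_in B]].

Lemma ex_k0 (R : realType) (n : nat) (p : R) :
  exists k : nat, 'C(n, k)%:R * p ^+ 'C(k, 2) < 1.
Proof. by exists n.+1; rewrite bin_small // mul0r ltr01. Qed.

Definition k0 (R : realType) (n : nat) (p : R) : nat := ex_minn (ex_k0 n p).

(* Main.v *)
Require Import Defs.
From HB Require Import structures.
From mathcomp Require Import all_boot all_order all_algebra.
From mathcomp Require Import all_classical all_reals all_analysis.
From mathcomp Require Import ring lra zify.

Set Implicit Arguments.
Unset Strict Implicit.
Unset Printing Implicit Defensive.

Import Order.TTheory GRing.Theory Num.Theory.
Import numFieldNormedType.Exports.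

Local Open Scope ring_scope.

(** Let [f G] be the largest number of edge-disjoint [k]-cliques of [G]; it is
    monotone and changes by at most [1] when an edge is added, so its variance
    is at most ['C(n, 2)] and by Chebyshev it is enough to bound its mean from
    below.  Given a set [H] of forbidden pairs, consider the mean [F H q] of
    [f (G \ H)] for edge probability [q].  If [A] is a [k]-set whose pairs avoid
    [H], then planting [A] gives [f ((G u A) \ H) >= 1 + f (G \ (H u A))].  When
    [A] is random and spread out, the law of [G u A] is close in mean square to
    that of the random graph with slightly larger edge probability [q + x],
    apart from linear terms that have the right sign because [f] is monotone.
    Hence [F H (q + x) >= 3/4 + E_A (F (H u A) q)].  Starting from [H = 0] and
    [q = p], this can be iterated about [p n^2 ln n / (20 k^4)] times before the
    expected number of [k]-cliques, initially almost [n^3], becomes too small;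
    an exponential potential shows that the degrees in [H] stay small
    meanwhile, which is what allows a spread-out [A] to be chosen. *)

(** Cauchy-Schwarz multiplies the mean square distance of the two densities by the variance of [f],
    for which only the bound of about n^2 / 2 is available; so that distance must be a small
    multiple of n^-2. Independent planted cliques sharing exactly one pair already contribute order
    k^4 / n^2, which is too much. This contribution is precisely the linear one, which is why the
    linear terms are projected away and left to monotonicity. The rest comes from overlaps in at
    least three vertices: order k^6 / n^3 for small overlaps, and about 1 / mu for full overlap,
    where mu is the expected number of k-cliques. Hence mu must exceed n^2 by some margin. The
    hypothesis C >= 4 makes it at least n^3 up to logarithmic factors, and the iteration may spend
    part of the extra factor n: blocked vertices cost at most n^(1/2) and the falling edge
    probability at most n^(1/16). Both exponents are proportional to the number of steps, and the
    constant 40 keeps them within the budget. *)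

(** * Random subsets *)

Section BernoulliSubset.
Context {R : realType} {T : finType}.
Implicit Types (U G A B : {set T}) (e : T) (p q x : R) (g h : {set T} -> R).

(** The ground set [U] is an argument, rather than the whole type, so that inductions can add one
    element at a time; [gnp_weight] is the case where [U] is the set of all pairs. *)
Definition bernoulli_weight U p G : R :=
  \prod_(e in U) (if e \in G then p else 1 - p).

Definition bernoulli_mean U p g : R :=
  \sum_(G in powerset U) bernoulli_weight U p G * g G.


Lemma bernoulli_weight_ge0 U p G : 0 <= p <= 1 -> 0 <= bernoulli_weight U p G.
Proof.
by move=> /andP[p0 p1]; apply: prodr_ge0 => e _; case: ifP => _ //; rewrite subr_ge0.
Qed.

Lemma eq_bernoulli_mean U p g h :
  (forall G, G \subset U -> g G = h G) ->
  bernoulli_mean U p g = bernoulli_mean U p h.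
Proof. by move=> gh; apply: eq_bigr => G; rewrite powersetE => /gh ->. Qed.

Lemma ler_bernoulli_mean U p g h : 0 <= p <= 1 ->
  (forall G, G \subset U -> g G <= h G) ->
  bernoulli_mean U p g <= bernoulli_mean U p h.
Proof.
move=> p01 gh; apply: ler_sum => G; rewrite powersetE => /gh gh'.
by rewrite ler_wpM2l // bernoulli_weight_ge0.
Qed.

Lemma bernoulli_meanD U p g h :
  bernoulli_mean U p (fun G => g G + h G) =
  bernoulli_mean U p g + bernoulli_mean U p h.
Proof. by rewrite -big_split /=; apply: eq_bigr => G _; rewrite mulrDr. Qed.

Lemma bernoulli_meanZ U p x g :
  bernoulli_mean U p (fun G => x * g G) = x * bernoulli_mean U p g.
Proof. by rewrite mulr_sumr; apply: eq_bigr => G _; rewrite mulrCA. Qed.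

Lemma bernoulli_meanB U p g h :
  bernoulli_mean U p (fun G => g G - h G) =
  bernoulli_mean U p g - bernoulli_mean U p h.
Proof. by rewrite -sumrB; apply: eq_bigr => G _; rewrite mulrBr. Qed.

Lemma bernoulli_mean_sum (I : finType) (P : pred I) U p (g : I -> {set T} -> R) :
  bernoulli_mean U p (fun G => \sum_(i | P i) g i G) =
  \sum_(i | P i) bernoulli_mean U p (g i).
Proof.
by rewrite exchange_big /=; apply: eq_bigr => G _; rewrite mulr_sumr.
Qed.

(** Conditioning on whether [e] is drawn. Every induction on [U] below rests on this. *)
Lemma bernoulli_mean_setU1 U p e g : e \notin U ->
  bernoulli_mean (e |: U) p g =
  p * bernoulli_mean U p (fun G => g (e |: G)) + (1 - p) * bernoulli_mean U p g.
Proof.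
move=> eU; rewrite /bernoulli_mean (bigID (fun G => e \in G)) /=; congr (_ + _).
  rewrite (reindex_onto (fun G => e |: G) (fun G => G :\ e)) /=; last first.
    by move=> G /andP[_ eG]; rewrite finset.setD1K.
  rewrite mulr_sumr; apply: eq_big => [G|G].
    rewrite !powersetE in_setU1 eqxx /= andbT.
    apply/andP/idP => [[sG /eqP eqG]|sG].
      have eG : e \notin G by rewrite -eqG setD11.
      apply/fintype.subsetP => x xG; have := fintype.subsetP sG x.
      rewrite !in_setU1 xG orbT => /(_ isT)/orP[/eqP xe|//].
      by rewrite -xe xG in eG.
    have eG : e \notin G by apply: contra eU; apply: (fintype.subsetP sG).
    by rewrite setU1K // eqxx finset.setUS.
  rewrite !powersetE => /andP[/andP[sG _] _].
  rewrite mulrA /bernoulli_weight big_setU1 //= in_setU1 eqxx /=.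
  congr (_ * _ * _); apply: eq_bigr => x xU.
  by rewrite in_setU1; case: eqVneq => // xe; rewrite -xe xU in eU.
rewrite mulr_sumr; apply: eq_big => [G|G].
  rewrite !powersetE; apply/andP/idP => [[sG eG]|sG].
    apply/fintype.subsetP => x xG; have := fintype.subsetP sG x xG.
    rewrite in_setU1 => /orP[/eqP xe|//]; by rewrite -xe xG in eG.
  split; first by apply: fintype.subset_trans sG (finset.subsetUr _ _).
  by apply: contra eU; apply: (fintype.subsetP sG).
move=> /andP[_ eG]; rewrite mulrA /bernoulli_weight big_setU1 //=.
by rewrite (negbTE eG).
Qed.

Lemma bernoulli_mean_split U p e g : e \in U ->
  bernoulli_mean U p g =
  p * bernoulli_mean (U :\ e) p (fun G => g (e |: G)) +
  (1 - p) * bernoulli_mean (U :\ e) p g.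
Proof.
move=> eU; rewrite -{1}(finset.setD1K eU) bernoulli_mean_setU1 //.
by rewrite setD11.
Qed.

Lemma bernoulli_mean0 p g : bernoulli_mean finset.set0 p g = g finset.set0.
Proof.
by rewrite /bernoulli_mean powerset0 big_set1 /bernoulli_weight big_set0 mul1r.
Qed.

Lemma set_ind (P : {set T} -> Prop) : P finset.set0 ->
  (forall e A, e \notin A -> P A -> P (e |: A)) -> forall A, P A.
Proof.
move=> P0 PS A; have [n] := ubnP #|A|; elim: n A => // n IH A.
have [->//|[e eA]] := set_0Vmem A.
rewrite (cardsD1 e) eA => ltA; rewrite -(finset.setD1K eA).
by apply: PS; [rewrite setD11|apply: IH].
Qed.

Lemma bernoulli_mean_prod U p (a b : R) :
  bernoulli_mean U p (fun G => \prod_(e in U) (if e \in G then a else b)) =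
  (p * a + (1 - p) * b) ^+ #|U|.
Proof.
elim/set_ind: U => [|e U eU IH]; first by rewrite bernoulli_mean0 big_set0 cards0.
rewrite bernoulli_mean_setU1 // cardsU1 eU add1n exprS -IH [RHS]mulrDl
  -[_ * a * _]mulrA -[_ * b * _]mulrA.
congr (_ * _ + _ * _); rewrite -bernoulli_meanZ; apply: eq_bernoulli_mean => G GU.
  rewrite big_setU1 //= in_setU1 eqxx; congr (_ * _); apply: eq_bigr => x xU.
  by rewrite in_setU1; case: eqVneq => // xe; rewrite -xe xU in eU.
rewrite big_setU1 //=; case: ifP => // eG.
by rewrite (fintype.subsetP GU _ eG) in eU.
Qed.

Lemma bernoulli_mean_cst U p x : bernoulli_mean U p (fun=> x) = x.
Proof.
elim/set_ind: U => [|e U eU IH]; first by rewrite bernoulli_mean0.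
by rewrite bernoulli_mean_setU1 // IH; ring.
Qed.

Lemma bernoulli_mean_indic1 U p e g : e \in U ->
  bernoulli_mean U p (fun G => (e \in G)%:R * g G) =
  p * bernoulli_mean U p (fun G => g (e |: G)).
Proof.
move=> eU; rewrite (bernoulli_mean_split p _ eU) [in RHS](bernoulli_mean_split p _ eU).
rewrite (@eq_bernoulli_mean _ _ _ (fun G => g (e |: G))); last first.
  by move=> G _; rewrite setU11 mul1r.
rewrite (@eq_bernoulli_mean _ _ (fun G => (e \in G)%:R * g G) (fun=> 0)); last first.
  move=> G GU; case: (boolP (e \in G)) => [eG|]; last by rewrite mul0r.
  by have := fintype.subsetP GU _ eG; rewrite setD11.
rewrite bernoulli_mean_cst [in RHS](@eq_bernoulli_mean _ _ _ (fun G => g (e |: G)));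
  first by ring.
by move=> G _; rewrite finset.setUA finset.setUid.
Qed.

(** Conditioning on [A \subset G] amounts to planting [A] in an unconditioned [G], which keeps the
    ground set [U] unchanged. *)
Lemma bernoulli_mean_indic U p A g : A \subset U ->
  bernoulli_mean U p (fun G => (A \subset G)%:R * g G) =
  p ^+ #|A| * bernoulli_mean U p (fun G => g (A :|: G)).
Proof.
elim/set_ind: A g => [|e A eA IH] g.
  move=> _; rewrite cards0 mul1r; apply: eq_bernoulli_mean => G _.
  by rewrite finset.sub0set mul1r finset.set0U.
rewrite finset.subUset finset.sub1set => /andP[eU AU].
rewrite cardsU1 eA add1n exprS -mulrA.
rewrite (@eq_bernoulli_mean _ _ _
  (fun G => (e \in G)%:R * ((A \subset G)%:R * g G))); last first.
  by move=> G _; rewrite finset.subUset finset.sub1set -mulnb natrM mulrA.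
rewrite bernoulli_mean_indic1 //; congr (_ * _).
rewrite (@eq_bernoulli_mean _ _ _ (fun G => (A \subset G)%:R * g (e |: G))).
  rewrite IH //; congr (_ * _); apply: eq_bernoulli_mean => G _.
  by rewrite finset.setUA.
move=> G _; congr ((_ : bool)%:R * _).
apply/idP/idP; last by move=> /fintype.subset_trans; apply; apply: finset.subsetUr.
move/fintype.subsetP => sA; apply/fintype.subsetP => x xA.
have := sA x xA; rewrite in_setU1 => /orP[/eqP xe|//].
by rewrite -xe xA in eA.
Qed.

Lemma bernoulli_mean_mem U p e : e \in U ->
  bernoulli_mean U p (fun G => (e \in G)%:R) = p.
Proof.
move=> eU; rewrite -[RHS]mulr1 -[X in p * X](bernoulli_mean_cst U p 1).
rewrite -(bernoulli_mean_indic1 p (fun=> 1) eU).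
by apply: eq_bernoulli_mean => G _; rewrite mulr1.
Qed.

(** A bound of Efron-Stein type: revealing the coordinates one by one, each adds at most [1] to the
    variance. *)
Lemma bernoulli_variance_le U p g : 0 <= p <= 1 ->
  (forall e G, `|g (e |: G) - g G| <= 1) ->
  bernoulli_mean U p (fun G => g G ^+ 2) - bernoulli_mean U p g ^+ 2 <= #|U|%:R.
Proof.
move=> p01; have /andP[p0 p1] := p01; elim/set_ind: U g => [|e U eU IH] g Lg.
  by rewrite !bernoulli_mean0 subrr.
rewrite !bernoulli_mean_setU1 // cardsU1 eU natrD.
have := IH g Lg.
have L2 : forall e' G, `|g (e |: (e' |: G)) - g (e |: G)| <= 1.
  by move=> e' G; rewrite finset.setUCA.
have := IH (fun G => g (e |: G)) L2.
have : `|bernoulli_mean U p (fun G => g (e |: G)) - bernoulli_mean U p g| <= 1.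
  rewrite -bernoulli_meanB ler_norml; apply/andP; split.
    rewrite -[leLHS](bernoulli_mean_cst U p (-1)); apply: ler_bernoulli_mean => // G _.
    by have := Lg e G; rewrite ler_norml => /andP[].
  rewrite -[leRHS](bernoulli_mean_cst U p 1); apply: ler_bernoulli_mean => // G _.
  by have := Lg e G; rewrite ler_norml => /andP[].
set a1 := bernoulli_mean U p (fun G => g (e |: G)); set a0 := bernoulli_mean U p g.
set b1 := bernoulli_mean U p (fun G => g (e |: G) ^+ 2).
set b0 := bernoulli_mean U p (fun G => g G ^+ 2); set N : R := #|U|%:R.
move=> d1 H1 H0; have d2 : (a1 - a0) ^+ 2 <= 1.
  by rewrite -real_normK ?num_real// expr_le1.
(* Law of total variance, conditioning on [e]. *)
have -> : p * b1 + (1 - p) * b0 - (p * a1 + (1 - p) * a0) ^+ 2 =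
  p * (b1 - a1 ^+ 2) + (1 - p) * (b0 - a0 ^+ 2) + p * (1 - p) * (a1 - a0) ^+ 2.
  by ring.
have h1 : p * (b1 - a1 ^+ 2) <= p * N by rewrite ler_wpM2l.
have h0 : (1 - p) * (b0 - a0 ^+ 2) <= (1 - p) * N by rewrite ler_wpM2l // subr_ge0.
have hp : p * (1 - p) <= 1 by nra.
have h2 : p * (1 - p) * (a1 - a0) ^+ 2 <= 1.
  by apply: mulr_ile1 => //; [rewrite mulr_ge0 // subr_ge0|rewrite sqr_ge0].
by rewrite /=; lra.
Qed.

Lemma bernoulli_cauchy_schwarz U p g h : 0 <= p <= 1 ->
  bernoulli_mean U p (fun G => g G * h G) ^+ 2 <=
  bernoulli_mean U p (fun G => g G ^+ 2) * bernoulli_mean U p (fun G => h G ^+ 2).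
Proof.
move=> p01.
set a := bernoulli_mean U p (fun G => g G ^+ 2).
set b := bernoulli_mean U p (fun G => h G ^+ 2).
set c := bernoulli_mean U p (fun G => g G * h G).
have a0 : 0 <= a.
  rewrite -[leLHS](bernoulli_mean_cst U p 0); apply: ler_bernoulli_mean => // G _.
  exact: sqr_ge0.
have b0 : 0 <= b.
  rewrite -[leLHS](bernoulli_mean_cst U p 0); apply: ler_bernoulli_mean => // G _.
  exact: sqr_ge0.
have H x : 0 <= x ^+ 2 * a - 2 * x * c + b.
  have -> : x ^+ 2 * a - 2 * x * c + b =
      bernoulli_mean U p (fun G => (x * g G - h G) ^+ 2).
    rewrite /a /b /c -!bernoulli_meanZ -bernoulli_meanB -bernoulli_meanD.
    by apply: eq_bernoulli_mean => G _; ring.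
  rewrite -[leLHS](bernoulli_mean_cst U p 0); apply: ler_bernoulli_mean => // G _.
  exact: sqr_ge0.
have [a_eq0|a_neq0] := eqVneq a 0.
  have c0 : c = 0.
    apply/eqP/negPn/negP => c_neq0.
    (* For [a = 0] the quadratic is affine in [x], and this [x] gives it the value [-1]. *)
    have := H ((b + 1) / (2 * c)); rewrite a_eq0 mulr0 sub0r.
    have -> : 2 * ((b + 1) / (2 * c)) * c = b + 1 by field.
    by lra.
  by rewrite c0 a_eq0 expr0n mul0r.
have a_gt0 : 0 < a by rewrite lt_def a_neq0.
have := H (c / a).
have -> : (c / a) ^+ 2 * a - 2 * (c / a) * c + b = (a * b - c ^+ 2) / a by field.
by rewrite pmulr_lge0 ?invr_gt0 // subr_ge0.
Qed.

End BernoulliSubset.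

(** * Planting a random set *)

Section Planting.
Context {R : realType} {T : finType}.
Implicit Types (U G A B : {set T}) (e : T) (p q x : R) (g h : {set T} -> R).

(** This covariance is a mean increment, so it is nonnegative for monotone [g]. *)
Lemma bernoulli_mean_centered U q e g : e \in U ->
  bernoulli_mean U q (fun G => g G * ((e \in G)%:R - q)) =
  q * (bernoulli_mean U q (fun G => g (e |: G)) - bernoulli_mean U q g).
Proof.
move=> eU; rewrite mulrBr -bernoulli_mean_indic1 // -bernoulli_meanZ.
by rewrite -bernoulli_meanB; apply: eq_bernoulli_mean => G _; ring.
Qed.

(** Pythagoras: the constant [1] and the centred coordinates are orthogonal, the latter with square
    norm [q * (1 - q)], and the subtracted terms are the projection of [h] on their span. *)
Lemma bernoulli_linear_remainder U q h (b : T -> R) : 0 < q < 1 ->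
  bernoulli_mean U q h = 1 ->
  (forall e, e \in U ->
    bernoulli_mean U q (fun G => h G * ((e \in G)%:R - q)) = b e) ->
  bernoulli_mean U q (fun G =>
    (h G - 1 - \sum_(e in U) b e / (q * (1 - q)) * ((e \in G)%:R - q)) ^+ 2) =
  bernoulli_mean U q (fun G => h G ^+ 2) - 1
    - \sum_(e in U) b e ^+ 2 / (q * (1 - q)).
Proof.
move=> /andP[q0 q1] h1 hb.
have qn0 : q * (1 - q) != 0 by apply: lt0r_neq0; rewrite mulr_gt0 // subr_gt0.
have Elin k c : (forall e, e \in U ->
    bernoulli_mean U q (fun G => k G * ((e \in G)%:R - q)) = c e) ->
  bernoulli_mean U q (fun G => k G *
    \sum_(e in U) b e / (q * (1 - q)) * ((e \in G)%:R - q)) =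
  \sum_(e in U) b e / (q * (1 - q)) * c e.
  move=> kc.
  rewrite (@eq_bernoulli_mean _ _ _ _ _ (fun G => \sum_(e in U)
     b e / (q * (1 - q)) * (k G * ((e \in G)%:R - q)))); last first.
    by move=> G _; rewrite mulr_sumr; apply: eq_bigr => e _; rewrite mulrCA.
  rewrite bernoulli_mean_sum; apply: eq_bigr => e eU.
  by rewrite bernoulli_meanZ kc.
set lin := fun G => \sum_(e in U) b e / (q * (1 - q)) * ((e \in G)%:R - q).
have E1 : bernoulli_mean U q (fun G => 1 * lin G) = 0.
  rewrite (Elin (fun=> 1) (fun=> 0)); first by rewrite big1 // => e _; rewrite mulr0.
  by move=> e eU; rewrite bernoulli_mean_centered // subrr mulr0.
have E2 : bernoulli_mean U q (fun G => lin G * lin G) =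
    \sum_(e in U) b e / (q * (1 - q)) * b e.
  apply: Elin => e eU; rewrite bernoulli_mean_centered //.
  rewrite -bernoulli_meanB.
  rewrite (@eq_bernoulli_mean _ _ _ _ _
    (fun G => b e / (q * (1 - q)) * (1 - (e \in G)%:R))).
    rewrite bernoulli_meanZ bernoulli_meanB bernoulli_mean_cst bernoulli_mean_mem //.
    by field; rewrite !lt0r_neq0 // subr_gt0.
  move=> G _; rewrite /lin (bigD1 e) //= [X in _ - X](bigD1 e) //= setU11.
  rewrite (eq_bigr (fun i => b i / (q * (1 - q)) * ((i \in G)%:R - q))).
    by rewrite (_ : true%:R = 1 :> R) //; ring.
  by move=> i /andP[_ ie]; rewrite in_setU1 (negbTE ie).
have E3 : bernoulli_mean U q (fun G => h G * lin G) =
    \sum_(e in U) b e / (q * (1 - q)) * b e by exact: Elin.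
rewrite (@eq_bernoulli_mean _ _ _ _ _ (fun G =>
  (h G ^+ 2 - (h G + h G) + 1) + lin G * lin G
  - (h G * lin G + h G * lin G) + (1 * lin G + 1 * lin G))); last first.
  by move=> G _; rewrite -/(lin G); ring.
rewrite !(bernoulli_meanB, bernoulli_meanD) E1 E2 E3 bernoulli_mean_cst h1.
have -> : \sum_(e in U) b e ^+ 2 / (q * (1 - q)) =
          \sum_(e in U) b e / (q * (1 - q)) * b e.
  by apply: eq_bigr => e _; rewrite expr2 mulrAC.
by ring.
Qed.

(** Change of measure: the product is the likelihood ratio of the two laws. *)
Lemma bernoulli_mean_tilt U q x g : 0 < q < 1 ->
  bernoulli_mean U (q + x) g = bernoulli_mean U q (fun G =>
    (\prod_(e in U) (if e \in G then (q + x) / q else (1 - (q + x)) / (1 - q)))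
    * g G).
Proof.
move=> /andP[q0 q1]; apply: eq_bigr => G _; rewrite mulrA -big_split /=.
congr (_ * _); apply: eq_bigr => e _; case: ifP => _; field.
  exact: lt0r_neq0.
by apply: lt0r_neq0; rewrite subr_gt0.
Qed.

(** The likelihood ratio has second moment [(1 + y) ^+ N]. Its constant and linear parts account for
    [1 + N * y], so only a quadratic remainder survives. *)
Lemma expr1D_le_quadratic (N : nat) (y : R) : 0 <= y -> N%:R * y <= 1 ->
  (1 + y) ^+ N <= 1 + N%:R * y + (N%:R * y) ^+ 2.
Proof.
move=> y0; elim: N => [|N IH] Ny; first by rewrite expr0 !mul0r expr0n !addr0.
have Ny' : N%:R * y <= 1.
  by apply: le_trans Ny; rewrite ler_wpM2r // ler_nat.
have N0 : 0 <= (N%:R : R) by rewrite ler0n.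
rewrite exprS; apply: (@le_trans _ _ ((1 + y) * (1 + N%:R * y + (N%:R * y) ^+ 2))).
  by rewrite ler_wpM2l ?IH // addr_ge0.
rewrite -[N.+1]addn1 natrD.
have : N%:R * y * (N%:R * y ^+ 2) <= 1 * (N%:R * y ^+ 2).
  by rewrite ler_wpM2r // mulr_ge0 // sqr_ge0.
have : 0 <= y ^+ 2 by rewrite sqr_ge0.
by nra.
Qed.

(* The law of [G u S i], with [i] drawn from [rho], and the Bernoulli law of
   parameter [q + x] have densities with respect to the Bernoulli law of
   parameter [q].  Their linear parts compare coefficientwise, and [g] has
   nonnegative covariance with each coordinate; what is left is controlled in
   mean square. *)
Lemma bernoulli_planting U q x (I : finType) (S : I -> {set T}) (rho : I -> R)
    g (N := #|U|%:R) (y := x ^+ 2 / (q * (1 - q))) (eps : R) :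
  0 < q < 1 -> 0 <= x -> N * y <= 1 ->
  (forall i, 0 <= rho i) -> \sum_i rho i = 1 ->
  (forall i, rho i != 0 -> S i \subset U) ->
  (forall e, e \in U -> \sum_(i | e \in S i) rho i <= x) ->
  (forall e G, g G <= g (e |: G) <= g G + 1) ->
  0 <= eps ->
  N * (2 * ((N * y) ^+ 2 + \sum_i \sum_(j | (1 < #|S i :&: S j|)%N)
                rho i * (rho j * q ^- #|S i :&: S j|))) <= eps ^+ 2 ->
  \sum_i rho i * bernoulli_mean U q (fun G => g (S i :|: G)) - eps <=
  bernoulli_mean U (q + x) g.
Proof.
move=> q01 x0 Ny1 rho0 rho1 SU rhox gmon eps0 small.
have /andP[q0 q1] := q01.
have q01' : 0 <= q <= 1 by rewrite !ltW.
have qn0 : q != 0 by exact: lt0r_neq0.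
have q'0 : 0 < 1 - q by rewrite subr_gt0.
have q'n0 : 1 - q != 0 by exact: lt0r_neq0.
have qq0 : 0 < q * (1 - q) by rewrite mulr_gt0.
pose P e := \sum_(i | e \in S i) rho i.
(* [L] is the density of the planted law: an indicator divided by its probability, averaged over
   [i]. Below, [D] is the density of the [q + x] law. *)
pose L G := \sum_i rho i * (q ^- #|S i| * (S i \subset G)%:R).
have EL k : bernoulli_mean U q (fun G => L G * k G) =
    \sum_i rho i * bernoulli_mean U q (fun G => k (S i :|: G)).
  rewrite (@eq_bernoulli_mean _ _ _ _ _ (fun G => \sum_i
     (rho i * q ^- #|S i|) * ((S i \subset G)%:R * k G))); last first.
    by move=> G _; rewrite mulr_suml; apply: eq_bigr => i _; rewrite !mulrA.
  rewrite bernoulli_mean_sum; apply: eq_bigr => i _; rewrite bernoulli_meanZ.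
  have [->|ri] := eqVneq (rho i) 0; first by rewrite !mul0r.
  by rewrite bernoulli_mean_indic ?SU // -mulrA mulKf // expf_neq0.
have EL1 : bernoulli_mean U q L = 1.
  rewrite -[RHS]rho1 -[LHS]mulr1; transitivity (bernoulli_mean U q (fun G => L G * 1)).
    by rewrite mulr1; apply: eq_bernoulli_mean => G _; rewrite mulr1.
  by rewrite EL; apply: eq_bigr => i _; rewrite bernoulli_mean_cst mulr1.
have ELe e : e \in U ->
    bernoulli_mean U q (fun G => L G * ((e \in G)%:R - q)) = (1 - q) * P e.
  move=> eU; rewrite EL /P mulr_sumr [RHS]big_mkcond /=; apply: eq_bigr => i _.
  rewrite (@eq_bernoulli_mean _ _ _ _ _ (fun G =>
     if e \in S i then 1 - q else (e \in G)%:R - q)); last first.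
    by move=> G _; rewrite finset.in_setU; case: ifP.
  case: ifP => _; first by rewrite bernoulli_mean_cst mulrC.
  by rewrite bernoulli_meanB bernoulli_mean_mem // bernoulli_mean_cst subrr mulr0.
have EL2 : bernoulli_mean U q (fun G => L G ^+ 2) =
    \sum_i \sum_j rho i * (rho j * q ^- #|S i :&: S j|).
  transitivity (bernoulli_mean U q (fun G => L G * L G)).
    by apply: eq_bernoulli_mean => G _; rewrite expr2.
  rewrite EL; apply: eq_bigr => i _; rewrite bernoulli_mean_sum mulr_sumr.
  apply: eq_bigr => j _; congr (_ * _).
  rewrite bernoulli_meanZ.
  have [->|rj] := eqVneq (rho j) 0; first by rewrite !mul0r.
  congr (_ * _); rewrite bernoulli_meanZ.
  rewrite (@eq_bernoulli_mean _ _ _ _ _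
      (fun G => (S j :\: S i \subset G)%:R * 1)); last first.
    by move=> G _; rewrite mulr1 finset.subDset.
  rewrite bernoulli_mean_indic; last first.
    by apply: fintype.subset_trans (SU j rj); apply: finset.subsetDl.
  rewrite bernoulli_mean_cst mulr1 -(cardsID (S i) (S j)) exprD invfM -mulrA mulVf.
    by rewrite mulr1 finset.setIC.
  by rewrite expf_neq0.
pose D G := \prod_(e in U) (if e \in G then (q + x) / q else (1 - (q + x)) / (1 - q)).
have ED k : bernoulli_mean U q (fun G => D G * k G) = bernoulli_mean U (q + x) k.
  by rewrite [RHS]bernoulli_mean_tilt.
have ED1 : bernoulli_mean U q D = 1.
  rewrite -[RHS](bernoulli_mean_cst U (q + x) 1) -ED.
  by apply: eq_bernoulli_mean => G _; rewrite mulr1.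
have EDe e : e \in U -> bernoulli_mean U q (fun G => D G * ((e \in G)%:R - q)) = x.
  by move=> eU; rewrite ED bernoulli_meanB bernoulli_mean_mem // bernoulli_mean_cst;
    ring.
have ED2 : bernoulli_mean U q (fun G => D G ^+ 2) = (1 + y) ^+ #|U|.
  rewrite (@eq_bernoulli_mean _ _ _ _ _ (fun G => \prod_(e in U)
     (if e \in G then ((q + x) / q) ^+ 2 else ((1 - (q + x)) / (1 - q)) ^+ 2)));
       last first.
    by move=> G _; rewrite -prodrXl; apply: eq_bigr => e _; case: ifP.
  rewrite bernoulli_mean_prod; congr (_ ^+ _); rewrite /y; field.
  by rewrite qn0 q'n0.
pose remL G := L G - 1 -
  \sum_(e in U) (1 - q) * P e / (q * (1 - q)) * ((e \in G)%:R - q).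
pose remD G := D G - 1 - \sum_(e in U) x / (q * (1 - q)) * ((e \in G)%:R - q).
have := bernoulli_linear_remainder q01 EL1 ELe; rewrite EL2 => RL.
have := bernoulli_linear_remainder q01 ED1 EDe; rewrite ED2 => RD.
have BD : bernoulli_mean U q (fun G => remD G ^+ 2) <= (N * y) ^+ 2.
  rewrite [leLHS]RD sumr_const -/y -[y *+ _]mulr_natl.
  have y0 : 0 <= y by rewrite divr_ge0 // ?sqr_ge0 // ltW.
  have := expr1D_le_quadratic y0 Ny1; rewrite -/N; lra.
set V := \sum_i \sum_(j | _) _ in small.
(* In the expansion over pairs [i], [j] with overlap [m], each pair has weight
   [q ^- m - 1 - m * (1 - q) / q]. This vanishes for [m = 0] and [m = 1], and is at most [q ^- m]
   otherwise. *)
have BL : bernoulli_mean U q (fun G => remL G ^+ 2) <= V.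
  rewrite [leLHS]RL.
  have -> : \sum_(e in U) ((1 - q) * P e) ^+ 2 / (q * (1 - q)) =
    \sum_i \sum_j rho i * (rho j * ((1 - q) / q * #|S i :&: S j|%:R)).
    transitivity (\sum_(e in U) \sum_i \sum_j
      rho i * (rho j * ((1 - q) / q * ((e \in S i) && (e \in S j))%:R))).
      apply: eq_bigr => e _; transitivity ((1 - q) / q * (P e * P e)).
        by field; rewrite qn0 q'n0.
      have PE : P e = \sum_i (e \in S i)%:R * rho i.
        rewrite /P big_mkcond; apply: eq_bigr => i _.
        by case: ifP; rewrite ?mul1r ?mul0r.
      rewrite PE mulr_suml mulr_sumr; apply: eq_bigr => i _.
      rewrite !mulr_sumr; apply: eq_bigr => j _.
      by rewrite -mulnb natrM; ring.
    rewrite exchange_big; apply: eq_bigr => i _.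
    rewrite exchange_big; apply: eq_bigr => j _.
    rewrite -!mulr_sumr; have [->|ri] := eqVneq (rho i) 0; first by rewrite !mul0r.
    congr (_ * (_ * (_ * _))); rewrite -natr_sum; congr (_%:R).
    rewrite -sum1_card -big_mkcondr /=; apply: eq_bigl => e.
    rewrite finset.in_setI andbA; case eSi : (e \in S i); rewrite ?andbF ?andbT //=.
    by rewrite (fintype.subsetP (SU i ri)).
  have one : (1 : R) = \sum_i \sum_j rho i * (rho j * 1).
    rewrite -[LHS]rho1; apply: eq_bigr => i _.
    by rewrite -mulr_sumr -mulr_suml rho1 !mulr1.
  rewrite [X in _ - X - _ <= _]one.
  rewrite -!sumrB; apply: ler_sum => i _; rewrite [leRHS]big_mkcond -!sumrB.
  apply: ler_sum => j _; set m := #|_|.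
  have rr : 0 <= rho i * rho j by rewrite mulr_ge0.
  have qm : 0 <= rho i * (rho j * ((1 - q) / q * m%:R)).
    by rewrite !mulr_ge0 // ?invr_ge0 ltW.
  case: ifP => [_|]; first by lra.
  case: (m) => [|[|//]] _.
    by rewrite expr0 invr1 mulr0; lra.
  by rewrite expr1 le_eqVlt; apply/orP; left; apply/eqP; field.
(* The difference of the linear coefficients of [D] and [L]; [P e <= x] makes it nonnegative
   although [P] varies with [e]. *)
pose c e := (x - (1 - q) * P e) / (q * (1 - q)).
have c0 e : e \in U -> 0 <= c e.
  move=> eU; apply: divr_ge0; last exact: ltW.
  rewrite subr_ge0; apply: le_trans (rhox e eU).
  rewrite -/(P e) -[leRHS]mul1r ler_wpM2r //; first by rewrite sumr_ge0.
  by rewrite lerBlDr lerDl ltW.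
pose m := bernoulli_mean U q g.
pose rem G := remD G - remL G.
have DL G : D G - L G = rem G + \sum_(e in U) c e * ((e \in G)%:R - q).
  rewrite /rem /remD /remL.
  have -> : \sum_(e in U) c e * ((e \in G)%:R - q) =
    \sum_(e in U) x / (q * (1 - q)) * ((e \in G)%:R - q) -
    \sum_(e in U) (1 - q) * P e / (q * (1 - q)) * ((e \in G)%:R - q).
    by rewrite -sumrB; apply: eq_bigr => e _; rewrite /c !mulrBl.
  by ring.
have Egc e : e \in U -> 0 <= bernoulli_mean U q (fun G => g G * ((e \in G)%:R - q)).
  move=> eU; rewrite bernoulli_mean_centered //; apply: mulr_ge0; first exact: ltW.
  rewrite subr_ge0.
  by apply: ler_bernoulli_mean => // G _; have /andP[] := gmon e G.
(* This lets [g] be centred before Cauchy-Schwarz, so that its variance enters and not its second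
   moment. *)
have Erem : bernoulli_mean U q rem = 0.
  have : bernoulli_mean U q (fun G => D G - L G) = 0.
    by rewrite bernoulli_meanB ED1 EL1 subrr.
  rewrite (@eq_bernoulli_mean _ _ _ _ _ _ (fun G _ => DL G)).
  rewrite bernoulli_meanD bernoulli_mean_sum [X in _ + X]big1 ?addr0 //.
  move=> e eU; rewrite bernoulli_meanZ bernoulli_meanB bernoulli_mean_mem //.
  by rewrite bernoulli_mean_cst subrr mulr0.
have Erem2 : bernoulli_mean U q (fun G => rem G ^+ 2) <= 2 * ((N * y) ^+ 2 + V).
  apply: (@le_trans _ _ (2 * (bernoulli_mean U q (fun G => remD G ^+ 2) +
     bernoulli_mean U q (fun G => remL G ^+ 2)))).
    rewrite -bernoulli_meanD -bernoulli_meanZ; apply: ler_bernoulli_mean => // G _.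
    rewrite /rem; move: (remD G) (remL G) => a b.
    by have := sqr_ge0 (a + b); lra.
  by rewrite ler_pM2l // lerD.
have Vg : bernoulli_mean U q (fun G => (g G - m) ^+ 2) <= N.
  have gL e G : `|g (e |: G) - g G| <= 1.
    by have /andP[h1 h2] := gmon e G; rewrite ler_norml; apply/andP; split; lra.
  apply: le_trans (bernoulli_variance_le U q01' gL).
  rewrite [leLHS](@eq_bernoulli_mean _ _ _ _ _
      (fun G => g G ^+ 2 - 2 * m * g G + m ^+ 2)).
    rewrite bernoulli_meanD bernoulli_meanB bernoulli_meanZ bernoulli_mean_cst -/m.
    by rewrite le_eqVlt; apply/orP; left; apply/eqP; ring.
  by move=> G _; ring.
have key : - eps <= bernoulli_mean U q (fun G => (g G - m) * rem G).
  have := bernoulli_cauchy_schwarz U (fun G => g G - m) rem q01'.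
  set z := bernoulli_mean U q (fun G => (g G - m) * rem G) => cs.
  have z2 : z ^+ 2 <= eps ^+ 2.
    apply: le_trans cs _; apply: le_trans small.
    apply: ler_pM => //.
      rewrite -[leLHS](bernoulli_mean_cst U q 0); apply: ler_bernoulli_mean => // G _.
      exact: sqr_ge0.
    rewrite -[leLHS](bernoulli_mean_cst U q 0); apply: ler_bernoulli_mean => // G _.
    exact: sqr_ge0.
  have : `|z| <= eps.
    by rewrite -(ger0_norm eps0) -ler_sqr ?nnegrE // !real_normK ?num_real.
  by rewrite ler_norml => /andP[].
rewrite -EL -ED lerBlDr -lerBlDl -bernoulli_meanB.
rewrite (@eq_bernoulli_mean _ _ _ _ _ (fun G =>
   - 1 * ((g G - m) * rem G + m * rem G +
   \sum_(e in U) c e * (g G * ((e \in G)%:R - q))))); last first.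
  move=> G _.
  have -> : \sum_(e in U) c e * (g G * ((e \in G)%:R - q)) =
      g G * (D G - L G - rem G).
    rewrite DL addrC addKr mulr_sumr; apply: eq_bigr => e _; exact: mulrCA.
  by ring.
rewrite bernoulli_meanZ !bernoulli_meanD bernoulli_meanZ Erem mulr0 addr0.
rewrite bernoulli_mean_sum.
have : 0 <= \sum_(e in U) bernoulli_mean U q (fun G => c e * (g G * ((e \in G)%:R - q))).
  by apply: sumr_ge0 => e eU; rewrite bernoulli_meanZ mulr_ge0 ?c0 ?Egc.
by lra.
Qed.

End Planting.

(** * Clique packings *)

Section Packing.
Variable n : nat.
Implicit Types (G H : {set {set 'I_n}}) (F : {set {set 'I_n}}) (A B J : {set 'I_n}).
Implicit Types (e : {set 'I_n}) (u v : 'I_n) (k : nat).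

Lemma card_pairs_in A : #|pairs_in A| = 'C(#|A|, 2).
Proof. by rewrite -cards_draws. Qed.

Lemma pairs_inI A B : pairs_in A :&: pairs_in B = pairs_in (A :&: B).
Proof.
apply/setP => e; rewrite !inE finset.subsetI.
by case: (_ \subset A); case: (_ \subset B); rewrite ?andbF //= andbb.
Qed.

Lemma pairs_inS A : pairs_in A \subset pairs_in [set: 'I_n].
Proof. by apply/fintype.subsetP => e; rewrite !inE => /andP[_ ->];
  rewrite finset.subsetT. Qed.

Lemma edge_disjoint_cliquesP G k F :
  reflect ((forall A, A \in F -> #|A| = k /\ pairs_in A \subset G) /\
    (forall A B, A \in F -> B \in F -> A != B ->
      [disjoint pairs_in A & pairs_in B]))
  (edge_disjoint_cliques G k F).
Proof.
apply: (iffP andP) => -[h1 h2]; split.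
- by move=> A AF; have /forall_inP/(_ A AF)/andP[/eqP] := h1.
- move=> A B AF BF AB; have /forall_inP/(_ A AF)/forall_inP/(_ B BF) := h2.
  by rewrite AB.
- by apply/forall_inP => A /h1[/eqP Ak AG]; apply/andP.
- apply/forall_inP => A AF; apply/forall_inP => B BF; apply/implyP.
  exact: h2.
Qed.

Definition packing_number k G : nat :=
  \max_(F : {set {set 'I_n}} | edge_disjoint_cliques G k F) #|F|.

Lemma packing_number_ge k G F :
  edge_disjoint_cliques G k F -> (#|F| <= packing_number k G)%N.
Proof. exact: leq_bigmax_cond. Qed.

Lemma packing_number_witness k G :
  exists2 F, edge_disjoint_cliques G k F & #|F| = packing_number k G.
Proof.
rewrite /packing_number; set P := (X in \max_(F | X F) _).
have [|F PF ->] := @eq_bigmax_cond _ P (fun F : {set {set 'I_n}} => #|F|).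
  apply/card_gt0P; exists finset.set0; apply/edge_disjoint_cliquesP.
  by split => [A|A B]; rewrite finset.in_set0.
by exists F.
Qed.

Lemma packing_number_mono k G G' :
  G \subset G' -> (packing_number k G <= packing_number k G')%N.
Proof.
move=> GG'; have [F /edge_disjoint_cliquesP[F1 F2] <-] := packing_number_witness k G.
apply: packing_number_ge; apply/edge_disjoint_cliquesP; split => //.
by move=> A /F1[-> AG]; split => //; apply: fintype.subset_trans GG'.
Qed.

(** At most one clique of an edge-disjoint family uses the pair [e]; dropping it leaves a packing of
    [G]. *)
Lemma packing_number_setU1 k e G :
  (packing_number k (e |: G) <= (packing_number k G).+1)%N.
Proof.
have [F /edge_disjoint_cliquesP[F1 F2] <-] := packing_number_witness k (e |: G).
pose Fe := [set A in F | e \in pairs_in A].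
have Fe1 : (#|Fe| <= 1)%N.
  rewrite leqNgt; apply/negP => /card_gt1P[A [B [AFe BFe AB]]].
  move: AFe BFe; rewrite [A \in _]finset.in_set [B \in _]finset.in_set.
  move=> /andP[AF eA] /andP[BF eB].
  by rewrite (disjointFr (F2 A B AF BF AB) eA) in eB.
rewrite -(cardsID Fe F) -add1n; apply: leq_add.
  by apply: leq_trans Fe1; rewrite subset_leq_card // finset.subsetIr.
apply: packing_number_ge; apply/edge_disjoint_cliquesP; split.
  move=> A; rewrite finset.in_setD [A \in Fe]finset.in_set => /andP[nA AF].
  have [Ak AG] := F1 A AF; split => //.
  apply/fintype.subsetP => e' e'A; have := fintype.subsetP AG e' e'A.
  rewrite in_setU1 => /orP[/eqP ee|//].
  by move: nA; rewrite AF -ee e'A.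
by move=> A B; rewrite !finset.in_setD => /andP[_ AF] /andP[_ BF]; apply: F2.
Qed.

(** An optimal packing that avoids the pairs of [A] can be extended by [A] itself. *)
Lemma packing_number_plant k A G H : (1 < k)%N -> #|A| = k ->
  [disjoint pairs_in A & H] ->
  ((packing_number k (G :\: (H :|: pairs_in A))).+1 <=
    packing_number k ((pairs_in A :|: G) :\: H))%N.
Proof.
move=> k1 Ak AH.
have [F /edge_disjoint_cliquesP[F1 F2] <-] :=
  packing_number_witness k (G :\: (H :|: pairs_in A)).
have FA B : B \in F -> [disjoint pairs_in A & pairs_in B].
  move=> /F1[_ BG]; rewrite disjoint_sym; apply/pred0P => e /=;
    apply/negP => /andP[eB eA].
  have := fintype.subsetP BG e eB.
  by rewrite finset.in_setD finset.in_setU eA orbT.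
(* Here [1 < k] matters: [A] has a pair, so it cannot be disjoint from its own pairs. *)
have AF : A \notin F.
  apply/negP => AF; have := FA A AF.
  have : (0 < #|pairs_in A|)%N by rewrite card_pairs_in Ak bin_gt0.
  by move=> /card_gt0P[e eA] AA; have := disjointFr AA eA; rewrite eA.
have -> : #|F|.+1 = #|A |: F| by rewrite cardsU1 AF.
apply: packing_number_ge; apply/edge_disjoint_cliquesP; split.
  move=> B; rewrite in_setU1 => /orP[/eqP ->|BF].
    split => //; apply/fintype.subsetP => e eA;
      rewrite finset.in_setD finset.in_setU eA /=.
    by rewrite andbT (disjointFr AH eA).
  have [Bk BG] := F1 B BF; split => //; apply/fintype.subsetP => e eB.
  have := fintype.subsetP BG e eB; rewrite !finset.in_setD !finset.in_setU.
  by rewrite negb_or => /andP[/andP[-> _] ->]; rewrite orbT.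
move=> B B'; rewrite !in_setU1 => /orP[/eqP ->|BF] /orP[/eqP ->|B'F].
- by rewrite eqxx.
- by move=> _; apply: FA.
- by move=> _; rewrite disjoint_sym; apply: FA.
- exact: F2.
Qed.

End Packing.

(** * Random [k]-sets avoiding the forbidden pairs *)

Section RandomIndependentSet.
Variables (R : realType) (n : nat) (H : {set {set 'I_n}}) (s : nat).
Implicit Types (A B J : {set 'I_n}) (v : 'I_n) (k : nat).

Definition free_vertices B : {set 'I_n} :=
  [set v | (v \notin B) && [forall b in B, [set v; b] \notin H]].

Lemma pairs_in_setU1 v B : v \in free_vertices B ->
  [disjoint pairs_in B & H] -> [disjoint pairs_in (v |: B) & H].
Proof.
rewrite finset.in_set => /andP[vB /forall_inP vH] BH; apply/pred0P => e /=.
apply/negP => /andP[]; rewrite [e \in pairs_in _]finset.in_set.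
move=> /andP[sub /cards2P[x [y [xy ee]]]] eH.
have /andP[xv yv] : (x \in v |: B) && (y \in v |: B).
  by apply/andP; split; apply: (fintype.subsetP sub); rewrite ee !inE eqxx ?orbT.
move: xv yv; rewrite !in_setU1 => /orP[/eqP xv|xB] /orP[/eqP yv|yB].
- by rewrite xv yv eqxx in xy.
- by have := vH y yB; rewrite -xv -ee eH.
- by have := vH x xB; rewrite -yv finset.setUC -ee eH.
- have := disjointFl BH eH; rewrite finset.in_set.
  by rewrite ee cards2 xy finset.subUset !finset.sub1set xB yB.
Qed.

(** Each vertex of [B] blocks itself and at most [d] neighbours in [H], whence [d.+1]. *)
Lemma card_free_vertices B d :
  (forall v, (#|[set u | [set u; v] \in H]| <= d)%N) ->
  (n <= #|free_vertices B| + #|B| * d.+1)%N.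
Proof.
move=> deg; rewrite -[X in (X <= _)%N]card_ord -(cardsC (free_vertices B)).
rewrite leq_add2l.
apply: (@leq_trans #|\bigcup_(b in B) (b |: [set u | [set u; b] \in H])|).
  apply: subset_leq_card; apply/fintype.subsetP => v;
    rewrite finset.in_setC finset.in_set.
  rewrite negb_and negbK => /orP[vB|].
    by apply/bigcupP; exists v => //; rewrite setU11.
  rewrite negb_forall => /existsP[b]; rewrite negb_imply negbK => /andP[bB vbH].
  by apply/bigcupP; exists b => //; rewrite in_setU1 finset.in_set vbH orbT.
apply: (@leq_trans (\sum_(b in B) d.+1)); last by rewrite sum_nat_const.
elim/big_ind2: _ => [|m1 X1 m2 X2 h1 h2|b bB]; first by rewrite cards0.
  by apply: leq_trans (leq_add h1 h2); rewrite cardsU leq_subr.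
by rewrite cardsU1 -add1n leq_add // leq_b1.
Qed.

(* [rho] is the law of the set built by adding [k] times a uniformly random
   free vertex. *)
Lemma random_independent_set k : (0 < s)%N ->
  (forall B, (#|B| < k)%N -> (s <= #|free_vertices B|)%N) ->
  exists rho : {set 'I_n} -> R,
    [/\ forall A, 0 <= rho A, \sum_A rho A = 1,
        forall A, rho A != 0 -> #|A| = k /\ [disjoint pairs_in A & H] &
        forall J, \sum_(A : {set 'I_n} | J \subset A) rho A <=
          (k ^_ #|J|)%:R / s%:R ^+ #|J|].
Proof.
move=> s0; elim: k => [|k IH] free.
  exists (fun A => (A == finset.set0)%:R); split.
  - by move=> A; rewrite ler0n.
  - rewrite (bigD1 finset.set0) //= eqxx big1 ?addr0 //.
    by move=> A /negbTE ->.
  - move=> A; have [-> _|_] := eqVneq A finset.set0; last by rewrite eqxx.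
    rewrite cards0; split => //; apply/pred0P => e /=;
      rewrite finset.in_set finset.subset0.
    by case: eqVneq => [->|]; rewrite ?cards0.
  - move=> J; rewrite big_mkcond (bigD1 finset.set0) //= big1 ?addr0; last first.
      by move=> A /negbTE ->; case: ifP.
    rewrite finset.subset0 eqxx; case: eqVneq => [->|J0].
      by rewrite cards0 ffactn0 expr0 divr1.
    by rewrite divr_ge0 ?exprn_ge0 // ler0n.
have [|rho [rho0 rho1 rhoS rhoJ]] := IH.
  by move=> B Bk; apply: free; apply: ltnW.
have W A : rho A != 0 -> (s <= #|free_vertices A|)%N.
  by move=> /rhoS[Ak _]; apply: free; rewrite Ak.
(* The mass of [A] is split evenly among its free vertices. If there are none, then [rho A = 0] and
   the division by zero is harmless. *)
pose w A : R := rho A / #|free_vertices A|%:R.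
have w0 A : 0 <= w A by rewrite divr_ge0 // ler0n.
have wW A : w A * #|free_vertices A|%:R = rho A.
  rewrite /w; have [->|rA] := eqVneq (rho A) 0; first by rewrite !mul0r.
  by rewrite divfK // pnatr_eq0 -lt0n; apply: leq_trans (W A rA).
have ws A : w A <= rho A / s%:R.
  rewrite /w; have [->|rA] := eqVneq (rho A) 0; first by rewrite !mul0r.
  rewrite ler_wpM2l // lef_pV2 ?posrE ?ltr0n // ?ler_nat ?W //.
  exact: leq_trans (W A rA).
exists (fun A' => \sum_A \sum_(v in free_vertices A | A' == v |: A) w A).
have sumE (P : pred {set 'I_n}) :
  \sum_(A' | P A') \sum_A \sum_(v in free_vertices A | A' == v |: A) w A =
  \sum_A \sum_(v in free_vertices A | P (v |: A)) w A.
  rewrite exchange_big; apply: eq_bigr => A _.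
  rewrite (exchange_big_dep (fun v => v \in free_vertices A)) /=; last first.
    by move=> A' v _ /andP[].
  rewrite [RHS]big_mkcondr; apply: eq_bigr => v vA.
  rewrite (eq_bigl (fun A' => (A' == v |: A) && P A')); last first.
    by move=> A'; rewrite vA andbC.
  by rewrite big_mkcondr big_pred1_eq.
split.
- by move=> A'; apply: sumr_ge0 => A _; apply: sumr_ge0.
- rewrite (sumE predT) -[RHS]rho1; apply: eq_bigr => A _.
  rewrite (eq_bigl (fun v => v \in free_vertices A)); last by move=> v; rewrite andbT.
  by rewrite sumr_const -mulr_natr wW.
- move=> A' nz.
  have [A [v [vA A'E rA]]] : exists A v,
      [/\ v \in free_vertices A, A' = v |: A & rho A != 0].
    apply: contrapT => nex; move/eqP: nz; apply.
    rewrite big1 // => A _; rewrite big1 // => v /andP[vA /eqP A'E].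
    apply/eqP; rewrite mulf_eq0; apply/orP; left; apply/negPn/negP => rA.
    by apply: nex; exists A, v.
  have [Ak AH] := rhoS A rA; rewrite A'E; split; last exact: pairs_in_setU1.
  by move: vA; rewrite finset.in_set cardsU1 Ak => /andP[-> _].
move=> J; rewrite sumE.
(* If [J \subset v |: A], then either [J] already lies in [A], or [v] is some [x] in [J] and the
   rest of [J] lies in [A]. A given [x] is drawn with probability at most [1 / s]. *)
apply: (@le_trans _ _ (\sum_(A : {set 'I_n}) ((J \subset A)%:R * rho A +
    \sum_(x in J) (J :\ x \subset A)%:R * (rho A / s%:R)))).
  apply: ler_sum => A _; rewrite big_mkcondr.
  apply: (@le_trans _ _ (\sum_(v in free_vertices A) ((J \subset A)%:R * w A +
     \sum_(x in J) (v == x)%:R * ((J :\ x \subset A)%:R * w A)))).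
    apply: ler_sum => v vA; case: ifP => [Jv|_]; last first.
      by rewrite addr_ge0 ?mulr_ge0 // sumr_ge0 // => x _; rewrite !mulr_ge0.
    have [vJ|vJ] := boolP (v \in J).
      rewrite (bigD1 v) //= eqxx mul1r finset.subDset Jv mul1r.
      rewrite [X in _ <= X]addrCA lerDl addr_ge0 ?mulr_ge0 //.
      by rewrite sumr_ge0 // => x _; rewrite !mulr_ge0.
    have -> : J \subset A.
      apply/fintype.subsetP => x xJ; have := fintype.subsetP Jv x xJ.
      by rewrite in_setU1 => /orP[/eqP xv|//]; rewrite -xv xJ in vJ.
    by rewrite mul1r lerDl sumr_ge0 // => x _; rewrite !mulr_ge0.
  rewrite big_split /= sumr_const -[X in X + _ <= _]mulr_natr -mulrA wW lerD2l.
  rewrite exchange_big; apply: ler_sum => x xJ; rewrite -mulr_suml.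
  apply: (@le_trans _ _ (1 * ((J :\ x \subset A)%:R * w A))).
    rewrite ler_wpM2r ?mulr_ge0 // -natr_sum lern1.
    rewrite -big_mkcondr /= sum1_card; apply: leq_trans (eq_leq (card1 x)).
    by apply: subset_leq_card; apply/fintype.subsetP => v; rewrite !inE => /andP[].
  by rewrite mul1r ler_wpM2l.
rewrite big_split /= exchange_big /=.
have ind (K : {set 'I_n}) :
    \sum_(A : {set 'I_n}) (K \subset A)%:R * rho A =
    \sum_(A : {set 'I_n} | K \subset A) rho A.
  rewrite [RHS]big_mkcond; apply: eq_bigr => A _.
  by case: ifP; rewrite ?mul1r ?mul0r.
rewrite ind; have [->|[x0 x0J]] := set_0Vmem J.
  rewrite big_set0 addr0 cards0 ffactn0; apply: le_trans (rhoJ _) _.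
  by rewrite cards0 ffactn0.
have Jpos : (0 < #|J|)%N by apply/card_gt0P; exists x0.
apply: (@le_trans _ _ ((k ^_ #|J|)%:R / s%:R ^+ #|J| +
   \sum_(x in J) (k ^_ #|J|.-1)%:R / s%:R ^+ #|J|.-1 / s%:R)).
  apply: lerD => //; apply: ler_sum => x xJ.
  under eq_bigr do rewrite mulrA.
  rewrite -mulr_suml ind ler_wpM2r ?invr_ge0 //; apply: le_trans (rhoJ _) _.
  by rewrite (cardsD1 x J) xJ.
rewrite sumr_const -[X in _ + X]mulr_natl.
case: (#|J|) Jpos => // j _ /=.
have sn0 : s%:R != 0 :> R by rewrite pnatr_eq0 -lt0n.
(* The Pascal rule for falling factorials; its two terms match the two cases above. *)
have -> : (k.+1 ^_ j.+1 = k ^_ j.+1 + j.+1 * k ^_ j)%N.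
  rewrite ffactSS ffactnSr; case: (leqP j k) => jk; last first.
    by rewrite (ffact_small jk) !muln0 mul0n.
  by nia.
rewrite natrD natrM exprSr mulrDl lerD2l.
by rewrite -!mulrA invfM.
Qed.

End RandomIndependentSet.

(** * The mean packing number *)

Section MeanPacking.
Variables (R : realType) (n k : nat).
Implicit Types (H : {set {set 'I_n}}) (A B J : {set 'I_n}) (v : 'I_n) (q : R).

(** A union bound over the [j]-subsets of a fixed [k]-set that the second clique contains. It starts
    at [3] because two sets sharing more than one pair share at least three vertices. *)
Definition overlap_sum (s : nat) q : R :=
  \sum_(3 <= j < k.+1)
    'C(k, j)%:R * ((k ^_ j)%:R / s%:R ^+ j * q ^- 'C(j, 2)).

Lemma overlap_second_moment (s : nat) q (rho : {set 'I_n} -> R) A :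
  0 < q -> #|A| = k -> (forall B, 0 <= rho B) ->
  (forall J, \sum_(B : {set 'I_n} | J \subset B) rho B <=
     (k ^_ #|J|)%:R / s%:R ^+ #|J|) ->
  \sum_(B | (1 < #|pairs_in A :&: pairs_in B|)%N)
     rho B * q ^- #|pairs_in A :&: pairs_in B| <= overlap_sum s q.
Proof.
move=> q0 Ak rho0 rhoJ.
have qi j : 0 <= q ^- j by rewrite invr_ge0 exprn_ge0 // ltW.
apply: (@le_trans _ _ (\sum_(B : {set 'I_n}) \sum_(J : {set 'I_n} |
    [&& J \subset A, (2 < #|J|)%N & J \subset B]) rho B * q ^- 'C(#|J|, 2))).
  rewrite big_mkcond; apply: ler_sum => B _; case: ifP => [AB|_]; last first.
    by apply: sumr_ge0 => J _; rewrite mulr_ge0.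
  move: AB; rewrite pairs_inI card_pairs_in => AB.
  (* Among all [J] in both sets, the term [J = A :&: B] alone is the wanted one. *)
  rewrite (bigD1 (A :&: B)) /=; last first.
    rewrite finset.subsetIl finset.subsetIr andbT /= ltnNge.
    by apply/negP; move: AB; case: #|_| => [|[|[|]]].
  by rewrite lerDl sumr_ge0 // => J _; rewrite mulr_ge0.
rewrite (exchange_big_dep (fun J : {set 'I_n} => (J \subset A) && (2 < #|J|)%N)) /=;
  last by move=> B J _ /and3P[-> ->].
apply: (@le_trans _ _ (\sum_(J : {set 'I_n} | (J \subset A) && (2 < #|J|)%N)
   (k ^_ #|J|)%:R / s%:R ^+ #|J| * q ^- 'C(#|J|, 2))).
  apply: ler_sum => J /andP[JA J2]; rewrite -mulr_suml ler_wpM2r //.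
  rewrite (eq_bigl (fun B : {set 'I_n} => J \subset B)) //.
  by move=> B; rewrite JA J2.
rewrite /overlap_sum big_geq_mkord /=.
rewrite (partition_big (fun J : {set 'I_n} => inord #|J| : 'I_k.+1)
  (fun j : 'I_k.+1 => (2 < j)%N)) /=; last first.
  move=> J /andP[JA J2]; rewrite inordK // ltnS -Ak; exact: subset_leq_card.
apply: ler_sum => j j2.
rewrite (eq_bigl (fun J => J \in [set J : {set 'I_n} | J \subset A & #|J| == j])).
  rewrite (eq_bigr (fun=> (k ^_ j)%:R / s%:R ^+ j * q ^- 'C(j, 2))).
    by rewrite sumr_const cards_draws Ak [leRHS]mulr_natl.
  by move=> J; rewrite finset.in_set => /andP[_ /eqP ->].
move=> J; rewrite finset.in_set; case: (boolP (J \subset A)) => //= JA.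
have Jk : (#|J| < k.+1)%N by rewrite ltnS -Ak subset_leq_card.
rewrite -val_eqE /= inordK //; case: eqVneq => [->|]; rewrite ?andbF ?andbT //.
Qed.

Definition mean_packing H q : R :=
  bernoulli_mean (pairs_in [set: 'I_n]) q
    (fun G => (packing_number k (G :\: H))%:R).

Lemma mean_packing_ge0 H q : 0 <= q <= 1 -> 0 <= mean_packing H q.
Proof.
move=> q01; rewrite -[leLHS](bernoulli_mean_cst (pairs_in [set: 'I_n]) q).
exact: ler_bernoulli_mean.
Qed.

(** The smallness condition of [bernoulli_planting], its double sum replaced by [overlap_sum]. *)
Definition step_error (s : nat) (x q : R) : R :=
  let N : R := 'C(n, 2)%:R in
  N * (2 * ((N * (x ^+ 2 / (q * (1 - q)))) ^+ 2 + overlap_sum s q)).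

(** Planting gains [1] and the comparison of laws loses [eps = 1/4]; [16^-1] is [eps ^+ 2]. *)
Lemma mean_packing_step H q (s : nat) (x := (k ^_ 2)%:R / s%:R ^+ 2) :
  (1 < k)%N -> (0 < s)%N ->
  (forall B, (#|B| < k)%N -> (s <= #|free_vertices H B|)%N) ->
  0 < q < 1 -> 'C(n, 2)%:R * (x ^+ 2 / (q * (1 - q))) <= 1 ->
  step_error s x q <= 16^-1 ->
  exists rho : {set 'I_n} -> R,
    [/\ forall A, 0 <= rho A, \sum_A rho A = 1,
        forall A, rho A != 0 -> #|A| = k,
        forall v, \sum_(A : {set 'I_n} | v \in A) rho A <= k%:R / s%:R &
        \sum_A rho A * mean_packing (H :|: pairs_in A) q + 3 / 4 <=
        mean_packing H (q + x)].
Proof.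
move=> k1 s0 free q01 Ny small; have /andP[q0 q1] := q01.
have q01' : 0 <= q <= 1 by rewrite !ltW.
have [rho [rho0 rho1 rhoS rhoJ]] := random_independent_set R s0 free.
exists rho; split => //.
- by move=> A /rhoS[].
- move=> v; have := rhoJ [set v]; rewrite cards1 ffactn1 expr1.
  by under eq_bigl do rewrite finset.sub1set.
pose U := pairs_in [set: 'I_n].
pose g (G : {set {set 'I_n}}) : R := (packing_number k (G :\: H))%:R.
have UN : #|U| = 'C(n, 2) by rewrite card_pairs_in cardsT card_ord.
have main : \sum_A rho A * bernoulli_mean U q (fun G => g (pairs_in A :|: G)) - 4^-1 <=
    bernoulli_mean U (q + x) g.
  apply: bernoulli_planting => //; rewrite ?UN //.
  - by rewrite divr_ge0 ?exprn_ge0.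
  - by move=> A _; exact: pairs_inS.
  - move=> e; rewrite finset.in_set => /andP[_ e2].
    have := rhoJ e; rewrite (eqP e2); apply: le_trans.
    rewrite le_eqVlt; apply/orP; left; apply/eqP.
    by apply: eq_bigl => A; rewrite finset.in_set e2 andbT.
  - move=> e G; rewrite /g natr1 !ler_nat; apply/andP; split.
      by apply: packing_number_mono; rewrite finset.setSD // finset.subsetUr.
    apply: leq_trans (packing_number_setU1 k e (G :\: H)).
    apply: packing_number_mono; rewrite finset.setDUl finset.setSU //.
    exact: finset.subsetDl.
  apply: le_trans (_ : _ <= 16^-1) _; last by lra.
  apply: le_trans small; rewrite /step_error ler_wpM2l // ler_pM2l // lerD2l.
  apply: (@le_trans _ _ (\sum_A rho A * overlap_sum s q)); last first.
    by rewrite -mulr_suml rho1 mul1r.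
  apply: ler_sum => A _; rewrite -mulr_sumr.
  have [->|/rhoS[Ak _]] := eqVneq (rho A) 0; first by rewrite !mul0r.
  by rewrite ler_wpM2l // overlap_second_moment.
apply: le_trans main.
have -> : (3 / 4 : R) = 1 - 4^-1 by lra.
rewrite addrA lerB // -[X in _ + X <= _]rho1 -big_split /=; apply: ler_sum => A _.
have [->|/rhoS[Ak AH]] := eqVneq (rho A) 0; first by rewrite !mul0r addr0.
rewrite -[X in _ + X]mulr1 -mulrDr ler_wpM2l //.
rewrite -[X in _ + X](bernoulli_mean_cst U q 1) -bernoulli_meanD.
apply: ler_bernoulli_mean => // G _; rewrite natr1 ler_nat.
exact: packing_number_plant.
Qed.

(* [c v] counts the removed cliques through [v].  The potential
   [\sum_v 2 ^ c v] grows by a factor at most [1 + k / s] per step on average,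
   so it certifies that the degrees in [H] stay bounded. *)
Lemma mean_packing_potential (s cap m : nat) (q0 : R)
    (x := (k ^_ 2)%:R / s%:R ^+ 2) :
  (1 < k)%N -> (0 < s)%N -> (s + k * (k * cap).+1 <= n)%N ->
  0 < q0 -> q0 + m%:R * x < 1 ->
  (forall j, (j < m)%N -> let q := q0 + j%:R * x in
     'C(n, 2)%:R * (x ^+ 2 / (q * (1 - q))) <= 1 /\ step_error s x q <= 16^-1) ->
  forall j H (c : 'I_n -> nat), (j <= m)%N ->
  (forall v, (#|[set u | [set u; v] \in H]| <= k * c v)%N) ->
  3 / 4 * j%:R *
    (1 - (1 + k%:R / s%:R) ^+ j * (\sum_v 2 ^+ c v) / 2 ^+ cap) <=
  mean_packing H (q0 + j%:R * x).
Proof.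
move=> k1 s0 scap q0_gt0 qm small.
have x0 : 0 <= x by rewrite divr_ge0 ?exprn_ge0.
have qj j : (j <= m)%N -> 0 < q0 + j%:R * x < 1.
  move=> jm; apply/andP; split; first by rewrite ltr_wpDr // mulr_ge0.
  by apply: le_lt_trans qm; rewrite lerD2l ler_wpM2r // ler_nat.
have qj' j : (j <= m)%N -> 0 <= q0 + j%:R * x <= 1.
  by move=> /qj /andP[h1 h2]; rewrite !ltW.
pose th : R := k%:R / s%:R.
have th0 : 0 <= th by rewrite divr_ge0.
have t0 : 0 <= 1 + th by rewrite addr_ge0.
(* [j] counts the steps still to come, while the edge probability descends to [q0]. *)
elim=> [|j IH] H c jm deg; first by rewrite mulr0 mul0r mean_packing_ge0 // qj'.
pose Phi j' (c' : 'I_n -> nat) : R := (1 + th) ^+ j' * (\sum_v 2 ^+ c' v) / 2 ^+ cap.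
rewrite -/th -/(Phi j.+1 c).
have Phi0 j' c' : 0 <= Phi j' c'.
  by rewrite !mulr_ge0 ?exprn_ge0 ?invr_ge0 ?exprn_ge0 ?sumr_ge0 // => v _;
    rewrite exprn_ge0.
(* A potential of at least [1] makes the claim trivial; a smaller one forces [c v <= cap] for every
   [v], hence enough free vertices. *)
case: (leP 1 (Phi j.+1 c)) => [Phi1|Phi1].
  apply: le_trans (_ : _ <= 0) _; last by rewrite mean_packing_ge0 // qj'.
  by rewrite mulr_ge0_le0 ?mulr_ge0 // subr_le0.
have ccap v : (c v <= cap)%N.
  rewrite leqNgt; apply/negP => cv; move: Phi1; apply/negP; rewrite -leNgt.
  rewrite /Phi -mulrA -[leLHS]mul1r; apply: ler_pM => //.
    by rewrite exprn_ege1 // lerDl.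
  rewrite ler_pdivlMr ?exprn_gt0 // mul1r (bigD1 v) //= -[leLHS]addr0.
  apply: lerD; first by rewrite ler_eXn2l ?ltr1n // ltnW.
  by apply: sumr_ge0 => w _; rewrite exprn_ge0.
have free B : (#|B| < k)%N -> (s <= #|free_vertices H B|)%N.
  move=> Bk.
  have degc v : (#|[set u | [set u; v] \in H]| <= k * cap)%N.
    by apply: leq_trans (deg v) _; rewrite leq_mul2l ccap orbT.
  have h := card_free_vertices B degc.
  have : (#|B| * (k * cap).+1 <= k * (k * cap).+1)%N by rewrite leq_mul2r ltnW ?orbT.
  by move: scap h; lia.
have [Ny1 err] := small j jm.
have [rho [rho0 rho1 rhok rhov main]] :=
  mean_packing_step k1 s0 free (qj j (ltnW jm)) Ny1 err.
have -> : q0 + j.+1%:R * x = q0 + j%:R * x + x by rewrite -natr1 mulrDl mul1r addrA.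
apply: le_trans main.
pose c' A v := (c v + (v \in A))%N.
have IHA A : rho A != 0 -> 3 / 4 * j%:R * (1 - Phi j (c' A)) <=
    mean_packing (H :|: pairs_in A) (q0 + j%:R * x).
  move=> rA; apply: IH; first exact: ltnW.
  move=> v; rewrite /c' mulnDr.
  apply: leq_trans (_ : _ <= #|[set u | [set u; v] \in H]| +
      #|[set u | [set u; v] \in pairs_in A]|)%N _.
    apply: leq_trans (leq_card_setU _ _); apply: subset_leq_card.
    by apply/fintype.subsetP => u; rewrite !finset.in_set.
  apply: leq_add => //; have [vA|vA] := boolP (v \in A).
    rewrite muln1 -(rhok A rA); apply: subset_leq_card; apply/fintype.subsetP => u.
    rewrite [u \in _]finset.in_set finset.in_set finset.subUset.
    by rewrite !finset.sub1set => /andP[/andP[]].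
  rewrite muln0 leqn0 cards_eq0; apply/eqP/setP => u.
  rewrite [u \in _]finset.in_set finset.in_set finset.subUset !finset.sub1set.
  by rewrite (negbTE vA) andbF finset.in_set0.
(* The term of [v] doubles exactly when [v \in A], which has probability at most [th]. *)
have avg : \sum_A rho A * Phi j (c' A) <= Phi j.+1 c.
  have -> : \sum_A rho A * Phi j (c' A) =
     (1 + th) ^+ j * (\sum_v 2 ^+ c v * \sum_A rho A * (1 + (v \in A)%:R)) / 2 ^+ cap.
    rewrite (eq_bigr (fun A : {set 'I_n} => (1 + th) ^+ j / 2 ^+ cap *
       \sum_v 2 ^+ c v * (rho A * (1 + (v \in A)%:R)))).
      rewrite -mulr_sumr exchange_big [RHS]mulrAC; congr (_ * _).
      by apply: eq_bigr => v _; rewrite mulr_sumr.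
    move=> A _; rewrite /Phi.
    have -> : \sum_v 2 ^+ c v * (rho A * (1 + (v \in A)%:R)) =
        rho A * \sum_v 2 ^+ c' A v.
      rewrite mulr_sumr; apply: eq_bigr => v _; rewrite mulrCA; congr (_ * _).
      by rewrite /c' exprD; case: (v \in A); rewrite ?expr1 ?expr0 ?addr0 // natr1.
    by ring.
  rewrite /Phi exprSr -!mulrA ler_wpM2l ?exprn_ge0 // !mulrA ler_wpM2r ?invr_ge0
    ?exprn_ge0 //.
  rewrite mulr_sumr; apply: ler_sum => v _; rewrite mulrC ler_wpM2r ?exprn_ge0 //.
  rewrite (eq_bigr (fun A : {set 'I_n} => rho A + (v \in A)%:R * rho A)); last first.
    by move=> A _; ring.
  rewrite big_split /= rho1 lerD2l; apply: le_trans (rhov v).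
  rewrite [leRHS]big_mkcond; apply: ler_sum => A _.
  by case: ifP; rewrite ?mul1r ?mul0r.
apply: (@le_trans _ _ (\sum_A rho A * (3 / 4 * j%:R * (1 - Phi j (c' A))) + 3 / 4)).
  have -> : \sum_A rho A * (3 / 4 * j%:R * (1 - Phi j (c' A))) =
      3 / 4 * j%:R * (1 - \sum_A rho A * Phi j (c' A)).
    rewrite -[X in X - _]rho1 -sumrB mulr_sumr; apply: eq_bigr => A _; ring.
  rewrite -natr1; have := Phi0 j.+1 c.
  have j0 : 0 <= (j%:R : R) by rewrite ler0n.
  have : j%:R * \sum_A rho A * Phi j (c' A) <= j%:R * Phi j.+1 c by rewrite ler_wpM2l.
  by nra.
rewrite lerD2r; apply: ler_sum => A _.
have [->|rA] := eqVneq (rho A) 0; first by rewrite !mul0r.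
by rewrite ler_wpM2l // IHA.
Qed.

End MeanPacking.

(** * Overlaps of random cliques, and concentration *)

Section OverlapSum.
Variables (R : realType) (k s : nat) (q : R).
Hypotheses (q0 : 0 < q) (q1 : q <= 1) (k_gt0 : (0 < k)%N) (ks : (k ^ 30 <= s)%N).

Let overlap_term j : R :=
  'C(k, j)%:R * ((k ^_ j)%:R / s%:R ^+ j * q ^- 'C(j, 2)).

Let s0 : 0 < s%:R :> R.
Proof. by rewrite ltr0n; apply: leq_trans ks; rewrite expn_gt0 k_gt0. Qed.

Let qge0 : 0 <= q. Proof. exact: ltW. Qed.

Let k1 : 1 <= k%:R :> R. Proof. by rewrite ler1n. Qed.

Let qV1 : 1 <= q^-1. Proof. by rewrite invf_ge1. Qed.

Let ks_real : k%:R ^+ 30 <= s%:R :> R.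
Proof. by rewrite -natrX ler_nat. Qed.

Let kX_le i : (i <= 30)%N -> k%:R ^+ i <= s%:R :> R.
Proof. by move=> i30; apply: le_trans ks_real; rewrite ler_weXn2l. Qed.

Lemma ffact_le_expn a b : (a ^_ b <= a ^ b)%N.
Proof.
elim: b => [|b IH]; first by rewrite ffactn0 expn0.
by rewrite ffactnSr expnSr leq_mul // leq_subr.
Qed.

Lemma bin_le_expn a b : ('C(a, b) <= a ^ b)%N.
Proof.
apply: leq_trans (ffact_le_expn a b); rewrite -bin_ffact leq_pmulr //.
exact: fact_gt0.
Qed.

Let overlap_term_le j :
  overlap_term j <= (k%:R ^+ 2 / s%:R) ^+ j * q ^- 'C(j, 2).
Proof.
rewrite /overlap_term mulrA ler_wpM2r ?invr_ge0 ?exprn_ge0 //.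
rewrite mulrA expr_div_n ler_wpM2r ?invr_ge0 ?exprn_ge0 //.
rewrite -exprM mul2n -addnn exprD; apply: ler_pM => //.
  by rewrite -natrX ler_nat bin_le_expn.
by rewrite -natrX ler_nat ffact_le_expn.
Qed.

Let overlap_term_small j : (3 <= j <= 5)%N ->
  overlap_term j <= (k%:R ^+ 2 / s%:R) ^+ 3 * q ^- 10.
Proof.
move=> /andP[j3 j5]; apply: le_trans (overlap_term_le j) _.
have r0 : 0 <= k%:R ^+ 2 / s%:R :> R by rewrite divr_ge0 ?exprn_ge0.
apply: ler_pM; rewrite ?exprn_ge0 ?invr_ge0 ?exprn_ge0 //.
  by apply: ler_wiXn2l => //; rewrite ler_pdivrMr // mul1r kX_le.
rewrite -!exprVn; apply: ler_weXn2l => //.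
by move: j3 j5; case: j => [|[|[|[|[|[|]]]]]].
Qed.

(** The hypothesis gives [q ^- 'C(j, 2) <= (s * k) ^ ((j - 1) / 2)]; squares are compared to avoid
    half-integer exponents. *)
Let overlap_term_middle j : (6 <= j)%N -> q ^- j <= s%:R * k%:R ->
  overlap_term j <= s%:R ^- 3.
Proof.
move=> j6 qj; apply: le_trans (overlap_term_le j) _.
have r0 : 0 <= k%:R ^+ 2 / s%:R :> R by rewrite divr_ge0 ?exprn_ge0.
rewrite -ler_sqr ?nnegrE ?mulr_ge0 ?invr_ge0 ?exprn_ge0 //.
have sk0 : 0 < s%:R * k%:R :> R by rewrite mulr_gt0 // ltr0n.
have H1 : (q ^- 'C(j, 2)) ^+ 2 <= (s%:R * k%:R) ^+ j / s%:R.
  rewrite -exprVn -exprM.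
  have -> : ('C(j, 2) * 2 = j * j.-1)%N by rewrite mulnC -mul_bin_diag bin1.
  case: j j6 qj => // j _ qj; rewrite exprM exprVn /= [(_ * _) ^+ j.+1]exprSr -mulrA.
  apply: (@le_trans _ _ ((s%:R * k%:R) ^+ j)).
    by rewrite lerXn2r ?nnegrE ?invr_ge0 ?exprn_ge0 //.
  by rewrite ler_peMr ?exprn_ge0 // mulrAC divff ?lt0r_neq0 // mul1r.
rewrite exprMn.
apply: (@le_trans _ _ (((k%:R ^+ 2 / s%:R) ^+ j) ^+ 2 * ((s%:R * k%:R) ^+ j / s%:R))).
  by rewrite ler_wpM2l ?sqr_ge0.
have -> : ((k%:R ^+ 2 / s%:R) ^+ j) ^+ 2 * ((s%:R * k%:R) ^+ j / s%:R) =
    (k%:R ^+ 5 / s%:R) ^+ j / s%:R :> R.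
  rewrite -exprM mulnC exprM mulrA -exprMn; congr (_ ^+ _ / _).
  by field; rewrite lt0r_neq0.
(* With six factors, [k ^ 5] becomes [k ^ 30], which is at most [s]: the origin of the exponent
   [30]. *)
apply: (@le_trans _ _ ((k%:R ^+ 5 / s%:R) ^+ 6 / s%:R)).
  rewrite ler_wpM2r ?invr_ge0 //; apply: ler_wiXn2l => //.
  by rewrite ler_pdivrMr // mul1r kX_le.
have -> : (s%:R ^- 3) ^+ 2 = s%:R / s%:R ^+ 6 / s%:R :> R.
  by field; rewrite lt0r_neq0.
rewrite expr_div_n -exprM ler_wpM2r ?invr_ge0 //.
by rewrite ler_wpM2r ?invr_ge0 ?exprn_ge0 //.
Qed.

(** In this range the terms increase with [j]: the factor [q ^- j] of a step outweighs the loss of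
    at most [s * k]. *)
Let overlap_term_large j : (j <= k)%N -> s%:R * k%:R <= q ^- j ->
  overlap_term j <= overlap_term k.
Proof.
move=> jk; have [d] := ubnP (k - j); elim: d j jk => // d IH j jk dj qj.
move: jk; rewrite leq_eqVlt => /orP[/eqP -> //|jk].
have step : overlap_term j <= overlap_term j.+1.
  rewrite /overlap_term binS bin1 exprD invfM exprSr invfM.
  have C1 : 'C(k, j)%:R <= k%:R * 'C(k, j.+1)%:R :> R.
    rewrite -natrM ler_nat; apply: (@leq_trans (j.+1 * 'C(k, j.+1))%N).
      by rewrite mul_bin_left leq_pmull // subn_gt0.
    by rewrite leq_mul2r jk orbT.
  have F1 : (k ^_ j)%:R <= (k ^_ j.+1)%:R :> R.
    by rewrite ler_nat ffactnSr leq_pmulr // subn_gt0.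
  have sj : 0 <= (s%:R ^+ j)^-1 :> R by rewrite invr_ge0 exprn_ge0.
  have qC : 0 <= q ^- 'C(j, 2) by rewrite invr_ge0 exprn_ge0.
  have key : 1 <= (k%:R * s%:R)^-1 * q ^- j.
    have ks0 : 0 < k%:R * s%:R :> R by rewrite mulr_gt0 // ltr0n.
    by rewrite -ler_pdivrMl ?invr_gt0 // invrK mulr1 mulrC.
  apply: (@le_trans _ _ (k%:R * 'C(k, j.+1)%:R * ((k ^_ j.+1)%:R / s%:R ^+ j *
      q ^- 'C(j, 2)) * ((k%:R * s%:R)^-1 * q ^- j))).
    apply: (@le_trans _ _ (k%:R * 'C(k, j.+1)%:R * ((k ^_ j.+1)%:R / s%:R ^+ j *
      q ^- 'C(j, 2)))).
      apply: ler_pM => //; first by rewrite !mulr_ge0.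
      by rewrite ler_wpM2r // ler_wpM2r.
    by rewrite ler_peMr // !mulr_ge0.
  rewrite le_eqVlt; apply/orP; left; apply/eqP.
  by field; rewrite !expf_neq0 ?lt0r_neq0 // ltr0n.
apply: le_trans step _; apply: IH => //; first by move: dj jk; lia.
apply: le_trans qj _; rewrite -!exprVn; exact: ler_weXn2l.
Qed.

(** The three hypotheses cover [j <= 5], the middle range and the increasing range; the last one
    bounds full overlap, roughly the inverse of the expected number of [k]-cliques. *)
Lemma overlap_sum_le b :
  (k%:R ^+ 2 / s%:R) ^+ 3 * q ^- 10 <= b -> s%:R ^- 3 <= b ->
  k`!%:R / s%:R ^+ k * q ^- 'C(k, 2) <= b ->
  overlap_sum k s q <= k%:R * b.
Proof.
move=> b1 b2 b3.
have b0 : 0 <= b by apply: le_trans b2; rewrite invr_ge0 exprn_ge0.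
apply: (@le_trans _ _ (\sum_(3 <= j < k.+1) b)); last first.
  by rewrite sumr_const_nat -[leLHS]mulr_natl ler_wpM2r // ler_nat; lia.
apply: ler_sum_nat => j /andP[j3 jk].
have [j5|j6] := leqP j 5; first by apply: le_trans b1; apply: overlap_term_small;
  rewrite j3.
case: (leP (q ^- j) (s%:R * k%:R)) => [qj|/ltW qj].
  by apply: le_trans b2; apply: overlap_term_middle.
apply: le_trans (overlap_term_large _ qj) _ => //.
by rewrite /overlap_term binn mul1r ffactnn.
Qed.

End OverlapSum.

(** Since the mean exceeds [t] by [t / 8], failure means a deviation of [t / 8], whence [64]. *)
Lemma bernoulli_chebyshev (R : realType) (T : finType) (U : {set T}) (p : R)
    (g : {set T} -> R) (t : R) : 0 <= p <= 1 ->
  (forall e G, `|g (e |: G) - g G| <= 1) -> 0 < t ->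
  9 / 8 * t <= bernoulli_mean U p g ->
  1 - 64 * #|U|%:R / t ^+ 2 <= bernoulli_mean U p (fun G => (t <= g G)%R%:R).
Proof.
move=> p01 Lg t0 mt; set m := bernoulli_mean U p g in mt.
have t2 : 0 < t ^+ 2 by rewrite exprn_gt0.
rewrite lerBlDr -lerBlDl -[X in X - _](bernoulli_mean_cst U p 1) -bernoulli_meanB.
apply: (@le_trans _ _ (64 / t ^+ 2 * bernoulli_mean U p (fun G => (g G - m) ^+ 2))).
  rewrite -bernoulli_meanZ; apply: ler_bernoulli_mean => // G _.
  case: (leP t (g G)) => gt.
    by rewrite (_ : true%:R = 1) // subrr mulr_ge0 ?sqr_ge0 ?divr_ge0 // ltW.
  rewrite subr0 mulrAC ler_pdivlMr // mul1r.
  have h : t / 8 <= m - g G by lra.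
  have : (t / 8) ^+ 2 <= (m - g G) ^+ 2.
    by rewrite ler_sqr ?nnegrE //; [lra|apply: le_trans h; lra].
  by rewrite -[(g G - m) ^+ 2]sqrrN opprB; lra.
rewrite [leRHS]mulrAC; apply: ler_wpM2l; first by rewrite divr_ge0 // ltW.
apply: le_trans (bernoulli_variance_le U p01 Lg); rewrite -/m.
rewrite [leLHS](@eq_bernoulli_mean _ _ _ _ _
  (fun G => g G ^+ 2 - 2 * m * g G + m ^+ 2)); last by move=> G _; ring.
rewrite bernoulli_meanD bernoulli_meanB bernoulli_meanZ bernoulli_mean_cst -/m.
by rewrite le_eqVlt; apply/orP; left; apply/eqP; ring.
Qed.

Section GnpPacking.
Variables (R : realType) (n k : nat) (p : R).
Hypothesis p01 : 0 <= p <= 1.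

Let has_packing (t : R) (G : {set {set 'I_n}}) :=
  [exists F : {set {set 'I_n}}, edge_disjoint_cliques G k F && (t <= #|F|%:R)].

Lemma gnp_probE (A : pred {set {set 'I_n}}) :
  gnp_prob p A = bernoulli_mean (pairs_in [set: 'I_n]) p (fun G => (A G)%:R).
Proof.
rewrite /gnp_prob /bernoulli_mean big_mkcondr; apply: eq_bigr => G _.
by case: ifP; rewrite ?mulr1 ?mulr0.
Qed.

Lemma gnp_prob_le1 (A : pred {set {set 'I_n}}) : gnp_prob p A <= 1.
Proof.
rewrite gnp_probE -[leRHS](bernoulli_mean_cst (pairs_in [set: 'I_n]) p 1).
by apply: ler_bernoulli_mean => // G _; rewrite lern1 leq_b1.
Qed.

Lemma gnp_prob_packing (t : R) : 0 < t ->
  9 / 8 * t <= mean_packing k (finset.set0 : {set {set 'I_n}}) p ->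
  1 - 64 * 'C(n, 2)%:R / t ^+ 2 <= gnp_prob p (has_packing t).
Proof.
move=> t0; rewrite /mean_packing.
under eq_bernoulli_mean do rewrite finset.setD0.
pose g (G : {set {set 'I_n}}) : R := (packing_number k G)%:R.
have Lg e G : `|g (e |: G) - g G| <= 1.
  have h1 : g G <= g (e |: G).
    by rewrite ler_nat packing_number_mono // finset.subsetUr.
  have h2 : g (e |: G) <= g G + 1 by rewrite /g natr1 ler_nat packing_number_setU1.
  by rewrite ler_norml; apply/andP; split; lra.
move=> /(bernoulli_chebyshev p01 Lg t0).
rewrite card_pairs_in cardsT card_ord => /le_trans; apply.
rewrite gnp_probE; apply: ler_bernoulli_mean => // G _; rewrite ler_nat.
case: (boolP (t <= g G)) => //= tg; rewrite lt0b; apply/existsP.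
have [F FG FE] := packing_number_witness k G.
by exists F; rewrite FG FE.
Qed.

End GnpPacking.

(** * The clique threshold *)

Section CliqueThreshold.
Variables (R : realType) (p : R) (n : nat).
Hypotheses (hp0 : 0 < p) (hp1 : p < 1).
Local Notation K := (k0 n p).
Local Notation L := (- ln p).
Local Notation mu j := ('C(n, j)%:R * p ^+ 'C(j, 2)).

Lemma k0_spec : mu K < 1 /\ forall j, (j < K)%N -> 1 <= mu j.
Proof.
rewrite /k0; case: ex_minnP => m mu1 mmin; split => // j jm.
by rewrite leNgt; apply/negP => /mmin; rewrite leqNgt jm.
Qed.

Lemma k0_gt0 : (0 < K)%N.
Proof.
case: k0_spec; case: K => // + _.
by rewrite bin0 mul1r expr0 ltxx.
Qed.

Lemma expr_as_expR j : p ^+ j = expR (- (j%:R * L)).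
Proof. by rewrite mulrN opprK expRM_natl lnK // posrE. Qed.

Lemma oppr_ln_gt0 : 0 < L.
Proof. by rewrite oppr_gt0 ln_lt0 // hp0. Qed.

(** With [r] the square root of [p], the bound [- ln r <= r^-1 - 1] gives
    [p * L <= 2 * (r - r ^+ 2)], which is at most [1/2]. *)
Lemma mul_oppr_ln_le_half : p * L <= 2^-1.
Proof.
pose r := Num.sqrt p.
have r0 : 0 < r by rewrite sqrtr_gt0.
have r2 : r ^+ 2 = p by rewrite sqr_sqrtr // ltW.
have h : - ln r <= r^-1 - 1.
  rewrite -lnV ?posrE //.
  have := @le_ln1Dx R (r^-1 - 1); rewrite [1 + _]addrC subrK; apply.
  by rewrite ltrBrDl subrr invr_gt0.
have -> : L = 2 * (- ln r) by rewrite -r2 lnXn // mulrN mulr_natl.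
have -> : p * (2 * - ln r) = 2 * (p * - ln r) by rewrite mulrCA.
have : p * - ln r <= p * (r^-1 - 1) by rewrite ler_wpM2l // ltW.
have -> : p * (r^-1 - 1) = r - p by rewrite -r2; field; rewrite lt0r_neq0.
by have := sqr_ge0 (r - 2^-1); rewrite -{3}r2; nra.
Qed.

(** From [1 <= mu (K - 1)] and ['C(n, j) <= n ^ j], on taking a [(K - 1)]-th root. *)
Lemma k0_upper : (0 < n)%N -> K%:R * L <= 2 * ln n%:R + 2 * L.
Proof.
move=> n0; have L0 := oppr_ln_gt0.
have l0 : 0 <= ln n%:R :> R by rewrite ln_ge0 // ler1n.
case E : K => [|[|j]]; first by rewrite mul0r; nra.
  by rewrite mul1r; nra.
have [_ /(_ j.+1)] := k0_spec; rewrite E ltnS leqnn => /(_ isT) mu1.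
have h : 1 <= expR (j.+1%:R * (ln n%:R - j%:R * L / 2)) :> R.
  apply: le_trans mu1 _.
  apply: (@le_trans _ _ (n%:R ^+ j.+1 * p ^+ 'C(j.+1, 2))).
    by rewrite ler_wpM2r ?exprn_ge0 ?(ltW hp0) // -natrX ler_nat bin_le_expn.
  rewrite expr_as_expR -{1}(@lnK R n%:R) ?posrE ?ltr0n // -expRM_natl -expRD ler_expR.
  have -> : 'C(j.+1, 2)%:R = j.+1%:R * j%:R / 2 :> R.
    have : ('C(j.+1, 2) * 2 = j.+1 * j)%N by rewrite mulnC -mul_bin_diag bin1.
    by move/(congr1 (fun i : nat => i%:R : R)); rewrite !natrM => <-; rewrite mulfK.
  by rewrite le_eqVlt; apply/orP; left; apply/eqP; ring.
have : 0 <= j.+1%:R * (ln n%:R - j%:R * L / 2) by rewrite -ler_expR expR0.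
rewrite pmulr_rge0 ?ltr0n // -[j.+2]addn2 natrD; lra.
Qed.

(** From [mu K < 1] and ['C(n, K) >= (n / (2 K)) ^ K]. Squaring turns ['C(K, 2)] into [K * (K - 1)],
    so a [K]-th root can be taken. *)
Lemma k0_lower : (2 * K <= n)%N -> n%:R ^+ 2 * p ^+ K.-1 <= (2 * K%:R) ^+ 2.
Proof.
move=> Kn; have K0 := k0_gt0; have [mu1 _] := k0_spec.
have K0' : 0 < K%:R :> R by rewrite ltr0n.
pose z : R := n%:R / (2 * K%:R).
have z0 : 0 <= z by rewrite divr_ge0 // mulr_ge0.
have binz : z ^+ K <= 'C(n, K)%:R.
  have h : ((n - K) ^ K <= 'C(n, K) * K ^ K)%N.
    apply: (@leq_trans (n ^_ K)).
      have : forall j, (j <= K)%N -> ((n - K) ^ j <= n ^_ j)%N.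
        elim=> [|j IH] jK; first by rewrite expn0 ffactn0.
        rewrite expnSr ffactnSr leq_mul ?IH //; first exact: ltnW.
        by apply: leq_sub2l; apply: ltnW.
      exact.
    by rewrite -bin_ffact leq_mul2l -ffactnn ffact_le_expn orbT.
  rewrite -(@ler_pM2r _ (K%:R ^+ K)) ?exprn_gt0 // -exprMn.
  apply: (@le_trans _ _ ((n - K)%:R ^+ K)).
    rewrite lerXn2r ?nnegrE ?mulr_ge0 //.
    have -> : z * K%:R = n%:R / 2 by rewrite /z; field; rewrite lt0r_neq0.
    rewrite natrB; last by move: Kn; lia.
    by move: Kn; rewrite -(ler_nat R) natrM; lra.
  by rewrite -!natrX -natrM ler_nat.
have zp : (z ^+ 2 * p ^+ K.-1) ^+ K < 1.
  have h : z ^+ K * p ^+ 'C(K, 2) < 1.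
    by apply: le_lt_trans mu1; rewrite ler_wpM2r ?exprn_ge0 ?(ltW hp0).
  have -> : (z ^+ 2 * p ^+ K.-1) ^+ K = (z ^+ K * p ^+ 'C(K, 2)) ^+ 2.
    rewrite [LHS]exprMn [RHS]exprMn -!exprM [(2 * K)%N]mulnC; congr (_ * _ ^+ _).
    by rewrite [RHS]mulnC -mul_bin_diag bin1 mulnC.
  by rewrite exprn_ilt1 // mulr_ge0 // exprn_ge0 // ltW.
have zp1 : z ^+ 2 * p ^+ K.-1 <= 1.
  rewrite leNgt; apply/negP => h; move: zp; apply/negP; rewrite -leNgt.
  by rewrite exprn_ege1 // ltW.
move: zp1; rewrite /z expr_div_n mulrAC ler_pdivrMr ?mul1r //.
by rewrite exprn_gt0 // mulr_gt0.
Qed.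

(* Each of the [C - 1 >= 3] steps from [K - 1] down to [K - C] multiplies the
   expected number of cliques by at least [n p ^ C / (2 K) ^ 2]. *)
Lemma expected_cliques_lower (C : nat) (nu := n%:R * p ^+ C / (2 * K%:R) ^+ 2) :
  (4 <= C)%N -> (C < K)%N -> (2 * K <= n)%N -> 1 <= nu ->
  nu ^+ 3 <= mu (K - C).
Proof.
move=> C4 CK Kn nu1; have [_ mumin] := k0_spec; have lowK := k0_lower Kn.
have K0' : 0 < K%:R :> R by rewrite ltr0n k0_gt0.
have K2 : 0 < (2 * K%:R) ^+ 2 :> R by rewrite exprn_gt0 // mulr_gt0.
have n0 : 0 < n%:R :> R by rewrite ltr0n; move: Kn CK; lia.
have step j : (K - C <= j)%N -> nu * mu j.+1 <= mu j.
  move=> Kj.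
  have h1 : 'C(n, j.+1)%:R <= n%:R * 'C(n, j)%:R :> R.
    rewrite -natrM ler_nat; apply: (@leq_trans (j.+1 * 'C(n, j.+1))%N).
      by rewrite leq_pmull.
    by rewrite mul_bin_left leq_mul2r leq_subr orbT.
  (* Since [K - 1 <= C + j], this reduces to [k0_lower]. *)
  have h2 : n%:R ^+ 2 * p ^+ C * p ^+ j <= (2 * K%:R) ^+ 2.
    apply: le_trans lowK; rewrite -mulrA -exprD ler_wpM2l ?exprn_ge0 //.
    by apply: ler_wiXn2l; [exact: ltW|exact: ltW|move: Kj; lia].
  have h3 : nu * (n%:R * p ^+ j) <= 1.
    have -> : nu * (n%:R * p ^+ j) = n%:R ^+ 2 * p ^+ C * p ^+ j / (2 * K%:R) ^+ 2.
      by rewrite /nu; field; rewrite lt0r_neq0.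
    by rewrite ler_pdivrMr // mul1r.
  rewrite binS bin1 exprD.
  apply: (@le_trans _ _ ((nu * (n%:R * p ^+ j)) * mu j)).
    have -> : nu * (n%:R * p ^+ j) * mu j =
      nu * (n%:R * 'C(n, j)%:R * (p ^+ 'C(j, 2) * p ^+ j)) by ring.
    rewrite ler_wpM2l; [|exact: le_trans nu1|].
      by [].
    by rewrite ler_wpM2r // mulr_ge0 // exprn_ge0 // ltW.
  by rewrite ler_piMl // mulr_ge0 // exprn_ge0 // ltW.
have iter i : (i < C)%N -> nu ^+ i <= mu (K - i.+1).
  elim: i => [|i IH] iC.
    by rewrite expr0 mumin // subn1 prednK // k0_gt0.
  rewrite exprS; apply: le_trans (step _ _); last by move: iC; lia.
  rewrite ler_wpM2l ?(le_trans _ nu1) //.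
  have -> : (K - i.+2).+1 = (K - i.+1)%N by move: iC CK; lia.
  by apply: IH; apply: ltnW.
have C1 : (C.-1 < C)%N by move: C4; lia.
have := iter C.-1 C1; rewrite prednK; last by move: C4; lia.
by apply: le_trans; apply: ler_weXn2l => //; move: C4; lia.
Qed.

End CliqueThreshold.

(** * Choice of the constants *)

Lemma invr_1Bx_expr_le (R : realType) (g : R) (i : nat) : 0 <= g <= 5^-1 ->
  ((1 - g)^-1) ^+ i <= expR (5 / 4 * g * i%:R).
Proof.
move=> /andP[g0 g1]; rewrite expRM_natr lerXn2r ?nnegrE ?expR_ge0 //.
  by rewrite invr_ge0; lra.
apply: le_trans (expR_ge1Dx _).
by rewrite -[leLHS]mul1r ler_pdivrMr; [nra|lra].
Qed.

Lemma natr_approx (R : realType) (x : R) : 0 <= x ->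
  exists m : nat, x <= m%:R <= x + 1.
Proof.
move=> x0; exists (Num.truncn x).+1.
have /andP[h1 h2] := truncn_itv x0.
by rewrite ltW //= -natr1 lerD2r.
Qed.

Section Constants.
Variables (R : realType) (p l w X : R) (C n k : nat).
Local Notation N := (n%:R : R).
Local Notation kr := (k%:R : R).
Hypotheses (hp0 : 0 < p) (hp1 : p < 1) (l2 : 2 <= l) (k1 : (1 < k)%N).
Hypotheses (wE : w = expR (l / 10)) (nE : N = expR l) (kX : kr <= X).
Hypotheses (lk : l <= - ln p * kr) (Lk : - ln p <= kr).

(** [d] lies below every power of [p] and [1 - p] that occurs. As [w] is [n ^ (1/10)], the single
    hypothesis [large] absorbs all constants and logarithmic factors; [X] will be [k0]. *)
Let d := p ^+ (10 + 3 * C) * (1 - p) ^+ 2.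

Hypothesis large : 2 ^+ 20 * X ^+ 30 <= d * w.
Hypothesis mu_ge :
  (N * p ^+ C / (2 * X) ^+ 2) ^+ 3 <= 'C(n, k)%:R * p ^+ 'C(k, 2).

Let t := p * N ^+ 2 * l / (40 * kr ^+ 4).

Let kr1 : 1 <= kr. Proof. by rewrite ler1n ltnW. Qed.
Let kr0 : 0 < kr. Proof. exact: lt_le_trans kr1. Qed.
Let X1 : 1 <= X. Proof. exact: le_trans kX. Qed.
Let X0 : 0 < X. Proof. exact: lt_le_trans X1. Qed.
Let l0 : 0 < l. Proof. exact: lt_le_trans l2. Qed.
Let w1 : 1 <= w.
Proof.
rewrite wE; apply: le_trans (expR_ge1Dx _); have := l0; lra.
Qed.
Let w0 : 0 < w. Proof. exact: lt_le_trans w1. Qed.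
Let nw : N = w ^+ 10.
Proof. by rewrite nE wE -expRM_natl mulrC divfK. Qed.
Let wN : w <= N. Proof. by rewrite nw ler_eXnr. Qed.
Let N0 : 0 < N. Proof. exact: lt_le_trans wN. Qed.
Let q1 : 0 < 1 - p. Proof. by rewrite subr_gt0. Qed.
Let d0 : 0 < d. Proof. by rewrite mulr_gt0 // exprn_gt0. Qed.

Let d_le_pX i : (i <= 10 + 3 * C)%N -> d <= p ^+ i.
Proof.
move=> iC; rewrite -[leRHS]mulr1 /d; apply: ler_pM;
  rewrite ?exprn_ge0 ?(ltW hp0) ?(ltW q1) //.
  by apply: ler_wiXn2l => //; exact: ltW.
by apply: exprn_ile1; [exact: ltW|have := hp0; lra].
Qed.

Let d_le_p : d <= p. Proof. by rewrite -[leRHS]expr1 d_le_pX. Qed.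

Let d_le_pq : d <= p * (1 - p).
Proof.
rewrite /d; apply: ler_pM; rewrite ?exprn_ge0 ?(ltW hp0) ?(ltW q1) //.
  by rewrite -[leRHS]expr1; apply: ler_wiXn2l => //; exact: ltW.
by rewrite expr2 ler_piMr ?(ltW q1) //; have := hp0; lra.
Qed.

Let baseX i j (del : R) : (i <= 20)%N -> (j <= 30)%N -> d <= del ->
  2 ^+ i * X ^+ j <= del * w.
Proof.
move=> i20 j30 ddel; apply: (@le_trans _ _ (d * w)); last first.
  by rewrite ler_wpM2r // ltW.
apply: le_trans large; apply: ler_pM; rewrite ?exprn_ge0 ?(ltW X0) //.
  by rewrite ler_weXn2l // ler1n.
by rewrite ler_weXn2l.
Qed.

Let base i j (del : R) : (i <= 20)%N -> (j <= 30)%N -> d <= del ->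
  2 ^+ i * kr ^+ j <= del * w.
Proof.
move=> i20 j30 ddel; apply: le_trans (baseX i20 j30 ddel).
by rewrite ler_wpM2l ?exprn_ge0 // lerXn2r ?nnegrE ?(ltW X0).
Qed.

(** [3 / 8 * tau] will bound the fraction of vertices blocked by a partial clique and its neighbours
    in [H]. *)
Let tau := p * l / kr.

Let tau_ge0 : 0 < tau. Proof. by rewrite divr_gt0 // mulr_gt0. Qed.

Let tau_le : tau <= 2^-1.
Proof.
rewrite ler_pdivrMr //; apply: le_trans (_ : p * (- ln p * kr) <= _).
  by rewrite ler_wpM2l // ltW.
by rewrite mulrA ler_wpM2r ?(ltW kr0) // mul_oppr_ln_le_half.
Qed.

Let t_ge10 : 10 <= t.
Proof.
rewrite ler_pdivlMr ?mulr_gt0 ?exprn_gt0 //.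
have h : 2 ^+ 9 * kr ^+ 4 <= p * w by apply: base.
have k4 : 0 <= kr ^+ 4 by rewrite exprn_ge0 // ltW.
have : p * w <= p * N ^+ 2 * l.
  rewrite -mulrA ler_wpM2l ?(ltW hp0) //.
  rewrite -[leLHS]mulr1; apply: ler_pM => //; first exact: ltW.
    apply: le_trans wN _; rewrite expr2 ler_peMl ?(ltW N0) //.
    exact: le_trans wN.
  by apply: le_trans l2; lra.
by lra.
Qed.

Let t0 : 0 < t. Proof. by have := t_ge10; lra. Qed.

(** * Number of steps, degree cap and number of free vertices *)

Section Choice.
Variables (m cap s : nat).
Local Notation mr := (m%:R : R).
Local Notation capr := (cap%:R : R).
Local Notation sr := (s%:R : R).
Hypotheses (m_ge : 2 * t <= mr) (m_le : mr <= 2 * t + 1).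
(** The average number of planted cliques through a vertex after all [m] steps. About [2 * t] steps
    are taken because each contributes [3 / 4], again reduced by [1 - 4^-1], and this gives
    [9 / 8 * t]. *)
Let M := mr * kr / N.
Hypotheses (cap_ge : 6 * M <= capr) (cap_le : capr <= 6 * M + 1).

Let m_le' : mr <= 15 / 7 * t.
Proof. by have := t_ge10; have := m_le; lra. Qed.

Let M_ge : 2 * l <= M.
Proof.
apply: (@le_trans _ _ (2 * t * kr / N)); last first.
  by rewrite ler_wpM2r ?invr_ge0 ?(ltW N0) // ler_wpM2r ?(ltW kr0).
have -> : 2 * t * kr / N = p * N / (20 * kr ^+ 3) * l.
  by rewrite /t; field; rewrite !lt0r_neq0.
rewrite ler_wpM2r ?(ltW l0) // ler_pdivlMr ?mulr_gt0 ?exprn_gt0 //.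
have h : 2 ^+ 6 * kr ^+ 3 <= p * w by apply: base.
have k3 : 0 <= kr ^+ 3 by rewrite exprn_ge0 // ltW.
have : p * w <= p * N by rewrite ler_wpM2l // ltW.
by lra.
Qed.

(** With [capr + 1 <= 7 * M] and [mr <= 15 / 7 * t], the left side is at most
    [15 * t * kr ^+ 3 / N]; the [40] in [t] turns [15] into [3 / 8]. *)
Let removed_le : kr * (kr * capr + 1) <= 3 / 8 * tau * N.
Proof.
have capM : capr + 1 <= 7 * M by have := M_ge; have := cap_le; have := l2; lra.
apply: (@le_trans _ _ (kr ^+ 2 * (7 * M))).
  apply: (@le_trans _ _ (kr ^+ 2 * (capr + 1))); last by rewrite ler_wpM2l ?sqr_ge0.
  by have := kr1; nra.
apply: (@le_trans _ _ (7 * (15 / 7 * t) * kr ^+ 3 / N)).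
  have -> : kr ^+ 2 * (7 * M) = 7 * mr * kr ^+ 3 / N by rewrite /M; field;
    rewrite lt0r_neq0.
  rewrite ler_wpM2r ?invr_ge0 ?(ltW N0) // ler_wpM2r ?exprn_ge0 ?(ltW kr0) //.
  by rewrite ler_wpM2l.
rewrite le_eqVlt; apply/orP; left; apply/eqP; rewrite /t /tau.
by field; rewrite !lt0r_neq0.
Qed.

Hypothesis sE : s = (n - k * (k * cap).+1)%N.

Let sr_ge : (1 - 3 / 8 * tau) * N <= sr.
Proof.
have e : (k * (k * cap).+1)%:R = kr * (kr * capr + 1) by rewrite natrM -natr1 natrM.
rewrite sE natrB; first by rewrite e; have := removed_le; lra.
rewrite -(ler_nat R) e; apply: le_trans removed_le _.
by rewrite ler_piMl ?(ltW N0) //; have := tau_le; lra.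
Qed.

Lemma choice_sum_le : (s + k * (k * cap).+1 <= n)%N.
Proof.
have s0 : 0 < sr.
  by apply: lt_le_trans sr_ge; rewrite mulr_gt0 //; have := tau_le; lra.
by move: s0; rewrite ltr0n sE subn_gt0 => /ltnW h; rewrite subnK.
Qed.

Let sr_ge' : 4 / 5 * N <= sr.
Proof.
by apply: le_trans sr_ge; rewrite ler_wpM2r ?(ltW N0) //; have := tau_le; lra.
Qed.

Let sr0 : 0 < sr. Proof. by apply: lt_le_trans sr_ge'; rewrite mulr_gt0. Qed.

Let sr_half : N / 2 <= sr.
Proof. by have := sr_ge'; have := N0; lra. Qed.

Lemma choice_s_gt0 : (0 < s)%N. Proof. by rewrite -(ltr0n R). Qed.

Lemma choice_kX_le : (k ^ 30 <= s)%N.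
Proof.
rewrite -(ler_nat R) natrX.
have h : 2 ^+ 1 * kr ^+ 30 <= p * w by apply: base.
have k30 : 0 <= kr ^+ 30 by rewrite exprn_ge0 // ltW.
have h2 : p * w <= N.
  by apply: le_trans wN; rewrite ler_piMl ?(ltW w0) ?(ltW hp1).
by have := sr_half; lra.
Qed.

Let x := (k ^_ 2)%:R / sr ^+ 2.

Let x_ge0 : 0 <= x. Proof. by rewrite divr_ge0 ?exprn_ge0 ?(ltW sr0). Qed.

Let x_le : x <= 8 / 5 * kr ^+ 2 / N ^+ 2.
Proof.
rewrite ler_pdivrMr ?exprn_gt0 //.
have h1 : (k ^_ 2)%:R <= kr ^+ 2 by rewrite -natrX ler_nat ffact_le_expn.
have h2 : (4 / 5 * N) ^+ 2 <= sr ^+ 2 by rewrite lerXn2r ?nnegrE ?mulr_ge0 ?(ltW N0)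
  ?(ltW sr0).
apply: le_trans h1 _.
apply: (@le_trans _ _ (8 / 5 * kr ^+ 2 / N ^+ 2 * (4 / 5 * N) ^+ 2)).
  have -> : 8 / 5 * kr ^+ 2 / N ^+ 2 * (4 / 5 * N) ^+ 2 = (1 + 3 / 125) * kr ^+ 2.
    by field; rewrite lt0r_neq0.
  by rewrite ler_peMl ?sqr_ge0 //; lra.
by rewrite ler_wpM2l // !mulr_ge0 ?invr_ge0 ?exprn_ge0 ?(ltW kr0) ?(ltW N0).
Qed.

(** The relative drop of the edge probability over the whole iteration. *)
Let z := mr * x / p.

Let z_le : z <= 3 / 35 * (l / kr ^+ 2).
Proof.
rewrite ler_pdivrMr //.
apply: (@le_trans _ _ ((15 / 7 * t) * (8 / 5 * kr ^+ 2 / N ^+ 2))).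
  by apply: ler_pM.
rewrite le_eqVlt; apply/orP; left; apply/eqP; rewrite /t.
by field; rewrite !lt0r_neq0.
Qed.

Let z_ge0 : 0 <= z. Proof. by rewrite divr_ge0 ?mulr_ge0 ?(ltW hp0). Qed.

Let z_small : z <= 10^-1.
Proof.
have : l / kr ^+ 2 <= 1.
  rewrite ler_pdivrMr ?exprn_gt0 // mul1r; apply: le_trans lk _.
  by rewrite expr2 ler_wpM2r ?(ltW kr0).
by have := z_le; lra.
Qed.

Let mx : mr * x = p * z. Proof. by rewrite /z [RHS]mulrC divfK ?lt0r_neq0. Qed.

Lemma choice_q0_gt0 : 0 < p - mr * x.
Proof. by rewrite mx subr_gt0; have := z_small; have := hp0; nra. Qed.

(** * Error of one step, uniformly in the edge probability *)

Section StepError.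
Variable q : R.
Hypotheses (q_ge : p - mr * x <= q) (q_le : q <= p).

Let q_ge' : p * (1 - z) <= q. Proof. by move: q_ge; rewrite mx; lra. Qed.

Let q_half : p / 2 <= q. Proof. by have := q_ge'; have := z_small; have := hp0;
  nra. Qed.

Let q0 : 0 < q. Proof. by have := q_half; have := hp0; lra. Qed.

Let Y := 'C(n, 2)%:R * (x ^+ 2 / (q * (1 - q))).

Let bin2_le : 'C(n, 2)%:R <= N ^+ 2 / 2.
Proof.
rewrite ler_pdivlMr // -natrM -natrX ler_nat mulnC -mul_bin_diag bin1.
by rewrite leq_mul2l leq_pred orbT.
Qed.

Let Y_le : Y <= (10 * N)^-1.
Proof.
have q'0 : 0 <= 1 - q by have := q_le; have := hp1; lra.
have qq : p * (1 - p) / 2 <= q * (1 - q).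
  have : 0 <= (q - p / 2) * (1 - p).
    by rewrite mulr_ge0 ?(ltW q1) // subr_ge0.
  have : 0 <= q * (p - q) by rewrite mulr_ge0 ?(ltW q0) // subr_ge0.
  lra.
have pp : 0 < p * (1 - p) by rewrite mulr_gt0.
have h : 2 ^+ 5 * kr ^+ 8 <= p * (1 - p) * w by apply: base.
have h' : 2 ^+ 5 * kr ^+ 4 <= p * (1 - p) * N.
  apply: le_trans (_ : p * (1 - p) * w <= _); last by rewrite ler_wpM2l ?(ltW pp).
  by apply: le_trans h; rewrite ler_wpM2l // ler_weXn2l.
have x2 : x ^+ 2 <= (8 / 5 * kr ^+ 2 / N ^+ 2) ^+ 2.
  by rewrite lerXn2r ?nnegrE // (le_trans x_ge0).
apply: (@le_trans _ _ (N ^+ 2 / 2 * ((8 / 5 * kr ^+ 2 / N ^+ 2) ^+ 2 /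
    (p * (1 - p) / 2)))).
  apply: ler_pM => //; first by rewrite divr_ge0 ?sqr_ge0 // mulr_ge0 ?(ltW q0).
  apply: ler_pM; rewrite ?sqr_ge0 ?invr_ge0 //.
    by rewrite mulr_ge0 ?(ltW q0).
  by rewrite lef_pV2 // posrE; lra.
have -> : N ^+ 2 / 2 * ((8 / 5 * kr ^+ 2 / N ^+ 2) ^+ 2 / (p * (1 - p) / 2)) =
    64 / 25 * kr ^+ 4 / (N ^+ 2 * (p * (1 - p))).
  by field; rewrite !lt0r_neq0.
rewrite ler_pdivrMr ?mulr_gt0 ?exprn_gt0 //.
have -> : (10 * N)^-1 * (N ^+ 2 * (p * (1 - p))) = p * (1 - p) * N / 10.
  by field; rewrite lt0r_neq0.
have : 0 <= kr ^+ 4 by rewrite exprn_ge0 // ltW.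
by lra.
Qed.

Lemma choice_quadratic_le1 : Y <= 1.
Proof.
apply: le_trans Y_le _; rewrite invf_le1 ?mulr_gt0 //.
by have := le_trans w1 wN; lra.
Qed.

Let Y_ge0 : 0 <= Y.
Proof.
rewrite mulr_ge0 // divr_ge0 ?sqr_ge0 // mulr_ge0 ?(ltW q0) // subr_ge0.
exact: le_trans q_le (ltW hp1).
Qed.

(** A bound for each overlap term: at most [kr] terms and the factor [N ^+ 2] leave [1/32]. *)
Let bnd := (2 ^+ 5 * N ^+ 2 * kr)^-1.

Let bnd_ge c : 0 <= c -> 2 ^+ 5 * kr * c <= N -> c / N ^+ 3 <= bnd.
Proof.
move=> c0 h; rewrite ler_pdivrMr ?exprn_gt0 //.
have -> : bnd * N ^+ 3 = N / (2 ^+ 5 * kr) by rewrite /bnd; field; rewrite !lt0r_neq0.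
by rewrite ler_pdivlMr ?mulr_gt0 // mulrC.
Qed.

Let bnd1 : (kr ^+ 2 / sr) ^+ 3 * q ^- 10 <= bnd.
Proof.
have h1 : kr ^+ 2 / sr <= 2 * kr ^+ 2 / N.
  rewrite ler_pdivrMr // mulrAC ler_pdivlMr //.
  have : kr ^+ 2 * (N / 2) <= kr ^+ 2 * sr by rewrite ler_wpM2l ?sqr_ge0.
  lra.
have h2 : q ^- 10 <= (p / 2) ^- 10.
  by rewrite lef_pV2 ?posrE ?exprn_gt0 ?divr_gt0 // lerXn2r ?nnegrE
    ?(ltW q0) // ltW // divr_gt0.
apply: (@le_trans _ _ ((2 * kr ^+ 2 / N) ^+ 3 * (p / 2) ^- 10)).
  apply: ler_pM => //;
    rewrite ?invr_ge0 ?exprn_ge0 ?divr_ge0 ?exprn_ge0 ?(ltW q0) ?(ltW sr0) //.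
  by rewrite lerXn2r ?nnegrE // ?divr_ge0 ?mulr_ge0 ?exprn_ge0 ?(ltW sr0) ?(ltW N0).
have -> : (2 * kr ^+ 2 / N) ^+ 3 * (p / 2) ^- 10 =
    (2 ^+ 13 * kr ^+ 6 / p ^+ 10) / N ^+ 3.
  by field; rewrite !lt0r_neq0.
apply: bnd_ge.
  by rewrite divr_ge0 ?mulr_ge0 ?exprn_ge0 ?(ltW hp0) ?(ltW kr0).
have -> : 2 ^+ 5 * kr * (2 ^+ 13 * kr ^+ 6 / p ^+ 10) = 2 ^+ 18 * kr ^+ 7 / p ^+ 10.
  by field; rewrite lt0r_neq0.
rewrite ler_pdivrMr ?exprn_gt0 //.
apply: (@le_trans _ _ (p ^+ 10 * w)).
  by apply: base => //; rewrite d_le_pX ?leq_addr.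
by rewrite mulrC ler_wpM2r ?exprn_ge0 ?(ltW hp0).
Qed.

Let bnd2 : sr ^- 3 <= bnd.
Proof.
apply: (@le_trans _ _ (2 ^+ 3 / N ^+ 3)).
  have h : (N / 2) ^+ 3 <= sr ^+ 3.
    by rewrite lerXn2r ?nnegrE ?(ltW sr0) // divr_ge0 // ltW.
  rewrite ler_pdivlMr ?exprn_gt0 // mulrC ler_pdivrMr ?exprn_gt0 //.
  have -> : N ^+ 3 = 2 ^+ 3 * (N / 2) ^+ 3 by field.
  by rewrite ler_wpM2l ?exprn_ge0.
apply: bnd_ge; first by rewrite exprn_ge0.
have h : 2 ^+ 8 * kr ^+ 1 <= p * w by apply: base.
have : p * w <= N by apply: le_trans wN; rewrite ler_piMl ?(ltW w0) ?(ltW hp1).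
by rewrite expr1 in h; lra.
Qed.

(** Full overlap gives at most [1 / mu], inflated by [(N / sr) ^+ k] for blocked vertices and by
    [(p / q) ^+ 'C(k, 2)] for the smaller edge probability. Together these cost at most [w ^+ 6],
    that is [n ^ (3/5)], against [mu >= nu ^+ 3]. *)
Let bnd3 : k`!%:R / sr ^+ k * q ^- 'C(k, 2) <= bnd.
Proof.
pose mu := 'C(n, k)%:R * p ^+ 'C(k, 2).
pose nu := N * p ^+ C / (2 * X) ^+ 2.
have nu0 : 0 < nu by rewrite divr_gt0 ?mulr_gt0 ?exprn_gt0 ?mulr_gt0.
have mu0 : 0 < mu by apply: lt_le_trans mu_ge; rewrite exprn_gt0.
have bin0 : 0 < 'C(n, k)%:R :> R.
  by move: mu0; rewrite /mu pmulr_lgt0 // exprn_gt0.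
have f1 : k`!%:R <= N ^+ k / 'C(n, k)%:R.
  rewrite ler_pdivlMr // -natrM -natrX ler_nat mulnC bin_ffact.
  exact: ffact_le_expn.
have ns : (N / sr) ^+ k <= expR (l / 2).
  pose g := 3 / 8 * tau.
  have g01 : 0 <= g <= 5^-1 by rewrite /g; have := tau_le; have := tau_ge0; lra.
  apply: (@le_trans _ _ (((1 - g)^-1) ^+ k)).
    rewrite lerXn2r ?nnegrE ?divr_ge0 ?(ltW N0) ?(ltW sr0) //.
      by rewrite invr_ge0; move: g01; lra.
    rewrite ler_pdivrMr // mulrC ler_pdivlMr 1?mulrC //; last by move: g01; lra.
  apply: le_trans (invr_1Bx_expr_le k g01) _; rewrite ler_expR.
  have -> : 5 / 4 * g * kr = 15 / 32 * (p * l).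
    by rewrite /g /tau; field; rewrite lt0r_neq0.
  have : p * l <= l by rewrite ler_piMl ?(ltW l0) ?(ltW hp1).
  have := l0; lra.
have pq : (p / q) ^+ 'C(k, 2) <= expR (l / 16).
  have z01 : 0 <= z <= 5^-1 by have := z_small; have := z_ge0; lra.
  apply: (@le_trans _ _ (((1 - z)^-1) ^+ 'C(k, 2))).
    rewrite lerXn2r ?nnegrE ?divr_ge0 ?(ltW hp0) ?(ltW q0) //.
      by rewrite invr_ge0; move: z01; lra.
    by rewrite ler_pdivrMr // mulrC ler_pdivlMr //; move: z01; lra.
  apply: le_trans (invr_1Bx_expr_le _ z01) _; rewrite ler_expR.
  have b2 : 'C(k, 2)%:R <= kr ^+ 2 / 2.
    rewrite ler_pdivlMr // -natrM -natrX ler_nat mulnC -mul_bin_diag bin1.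
    by rewrite leq_mul2l leq_pred orbT.
  apply: (@le_trans _ _ (5 / 4 * (3 / 35 * (l / kr ^+ 2)) * (kr ^+ 2 / 2))).
    apply: ler_pM => //; first by rewrite mulr_ge0.
    by rewrite ler_wpM2l.
  have -> : 5 / 4 * (3 / 35 * (l / kr ^+ 2)) * (kr ^+ 2 / 2) = 3 / 56 * l.
    by field; rewrite lt0r_neq0.
  have := l0; lra.
have w6 : expR (l / 2) * expR (l / 16) <= w ^+ 6.
  rewrite -expRD wE -expRM_natl ler_expR; have := l0; lra.
apply: (@le_trans _ _ (w ^+ 6 / mu)).
  apply: (@le_trans _ _ ((N / sr) ^+ k * (p / q) ^+ 'C(k, 2) / mu)).
    have -> : (N / sr) ^+ k * (p / q) ^+ 'C(k, 2) / mu =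
        N ^+ k / 'C(n, k)%:R / sr ^+ k * q ^- 'C(k, 2).
      rewrite /mu !expr_div_n; field.
      by rewrite !expf_neq0 ?lt0r_neq0.
    rewrite ler_wpM2r ?invr_ge0 ?exprn_ge0 ?(ltW q0) //.
    by rewrite ler_wpM2r ?invr_ge0 ?exprn_ge0 ?(ltW sr0).
  rewrite ler_wpM2r ?invr_ge0 ?(ltW mu0) //; apply: le_trans w6.
  by apply: ler_pM; rewrite ?exprn_ge0 ?divr_ge0 ?(ltW N0) ?(ltW sr0) ?(ltW hp0)
    ?(ltW q0).
apply: (@le_trans _ _ (w ^+ 6 / nu ^+ 3)).
  by rewrite ler_wpM2l ?exprn_ge0 ?(ltW w0) // lef_pV2 ?posrE ?exprn_gt0.
have -> : w ^+ 6 / nu ^+ 3 = (2 ^+ 6 * w ^+ 6 * X ^+ 6 / (p ^+ C) ^+ 3) / N ^+ 3.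
  rewrite /nu; field; rewrite !lt0r_neq0 //; exact: exprn_gt0.
apply: bnd_ge.
  by rewrite divr_ge0 ?mulr_ge0 ?exprn_ge0 ?(ltW w0) ?(ltW X0) ?(ltW hp0).
have -> : 2 ^+ 5 * kr * (2 ^+ 6 * w ^+ 6 * X ^+ 6 / (p ^+ C) ^+ 3) =
    (2 ^+ 11 * w ^+ 6 * (X ^+ 6 * kr)) / (p ^+ C) ^+ 3.
  by field; rewrite lt0r_neq0 // exprn_gt0.
rewrite ler_pdivrMr ?exprn_gt0 //.
have h : 2 ^+ 11 * X ^+ 7 <= p ^+ (3 * C) * w.
  by apply: baseX => //; rewrite d_le_pX ?leq_addl.
apply: (@le_trans _ _ (w ^+ 6 * (2 ^+ 11 * X ^+ 7))).
  have -> : w ^+ 6 * (2 ^+ 11 * X ^+ 7) = 2 ^+ 11 * w ^+ 6 * (X ^+ 6 * X) by ring.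
  by rewrite ler_wpM2l ?mulr_ge0 ?exprn_ge0 ?(ltW w0) // ler_wpM2l ?exprn_ge0 ?(ltW X0).
apply: (@le_trans _ _ (w ^+ 6 * (p ^+ (3 * C) * w))).
  by rewrite ler_wpM2l ?exprn_ge0 ?(ltW w0).
rewrite mulnC exprM mulrCA -exprSr [leRHS]mulrC ler_wpM2l ?exprn_ge0 ?(ltW hp0) //.
by rewrite nw ler_weXn2l.
Qed.

Lemma choice_step_error_le : step_error n k s x q <= 16^-1.
Proof.
have T : overlap_sum k s q <= kr * bnd.
  apply: overlap_sum_le => //; first exact: le_trans q_le (ltW hp1).
    exact: ltnW.
  exact: choice_kX_le.
have Y2 : Y ^+ 2 <= ((10 * N)^-1) ^+ 2.
  by rewrite lerXn2r ?nnegrE // (le_trans Y_ge0 Y_le).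
rewrite /step_error -/Y.
apply: (@le_trans _ _ (N ^+ 2 / 2 * (2 * (((10 * N)^-1) ^+ 2 + kr * bnd)))).
  apply: ler_pM => //.
    rewrite mulr_ge0 // addr_ge0 ?sqr_ge0 // sumr_ge0 // => i _.
    by rewrite !mulr_ge0 ?invr_ge0 ?exprn_ge0 ?(ltW sr0) ?(ltW q0).
  by rewrite ler_wpM2l // lerD.
(* The budget: [1/100 + 1/32] is below [1/16]. *)
have -> : N ^+ 2 / 2 * (2 * (((10 * N)^-1) ^+ 2 + kr * bnd)) = 10^-1 ^+ 2 + 2 ^- 5.
  by rewrite /bnd; field; rewrite !lt0r_neq0.
lra.
Qed.

End StepError.

Lemma choice_potential_le :
  (1 + kr / sr) ^+ m * (\sum_(v < n) 2 ^+ 0) / 2 ^+ cap <= 4^-1 :> R.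
Proof.
rewrite sumr_const card_ord expr0.
have h1 : (1 + kr / sr) ^+ m <= expR (5 / 4 * M).
  apply: (@le_trans _ _ (expR (kr / sr) ^+ m)).
    have a0 : 0 <= 1 + kr / sr by rewrite addr_ge0 // divr_ge0 ?(ltW sr0).
    apply: lerXn2r; rewrite ?nnegrE ?expR_ge0 //; exact: expR_ge1Dx.
  rewrite -expRM_natl ler_expR /M mulrA ler_pdivrMr // mulrA mulrAC ler_pdivlMr //.
  have : mr * kr * (4 / 5 * N) <= mr * kr * sr.
    by rewrite ler_wpM2l // mulr_ge0.
  lra.
(* The factor [6] in [cap] combines [3] with the crude bound [2 >= expR (1/2)]. The exponent [3 * M]
   beats the growth [5 / 4 * M] and the initial [N = expR l], because [M >= 2 * l]. *)
have h2 : expR (3 * M) <= 2 ^+ cap.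
  have e2 : expR (2^-1) <= 2 :> R.
    have : 2^-1 <= expR (- 2^-1) :> R by apply: le_trans (expR_ge1Dx _); lra.
    by rewrite expRN lef_pV2 ?posrE ?expR_gt0.
  apply: (@le_trans _ _ (expR (2^-1) ^+ cap)).
    by rewrite -expRM_natl ler_expR; have := cap_ge; lra.
  by rewrite lerXn2r ?nnegrE ?expR_ge0.
rewrite ler_pdivrMr ?exprn_gt0 // nE.
apply: (@le_trans _ _ (expR (5 / 4 * M) * expR l)).
  by rewrite ler_wpM2r ?expR_ge0.
apply: (@le_trans _ _ (4^-1 * expR (3 * M))); last by rewrite ler_wpM2l.
have h3 : 4 * expR (5 / 4 * M + l) <= expR (3 * M).
  have -> : 3 * M = (5 / 4 * M + l) + (7 / 4 * M - l) by lra.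
  rewrite [leRHS]expRD mulrC ler_wpM2l ?expR_ge0 //.
  apply: le_trans (expR_ge1Dx _); have := M_ge; have := l2; lra.
by rewrite -expRD; lra.
Qed.

End Choice.

Lemma mean_packing_large :
  9 / 8 * t <= mean_packing k (finset.set0 : {set {set 'I_n}}) p.
Proof.
have [|m /andP[m_ge m_le]] := @natr_approx R (2 * t); first by have := t0; lra.
have M0 : 0 <= 6 * (m%:R * kr / N) by rewrite mulr_ge0 // divr_ge0
  ?(ltW N0) // mulr_ge0.
have [cap /andP[cap_ge cap_le]] := natr_approx M0.
pose s := (n - k * (k * cap).+1)%N.
pose x : R := (k ^_ 2)%:R / s%:R ^+ 2.
have x0 : 0 <= x by rewrite divr_ge0 ?exprn_ge0.
have s0 : (0 < s)%N by apply: (@choice_s_gt0 m cap).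
have q0 : 0 < p - m%:R * x by apply: (@choice_q0_gt0 m cap).
have pot := @choice_potential_le m cap s m_ge m_le cap_ge cap_le erefl.
rewrite -[p](subrK (m%:R * x)).
apply: (@le_trans _ _ (3 / 4 * m%:R * (1 - 4^-1))); first by lra.
(* The iteration is anchored at [p - m%:R * x], so that its top level [j = m] is exactly [p]. *)
apply: le_trans (@mean_packing_potential R n k s cap m (p - m%:R * x)
  k1 s0 _ q0 _ _ m finset.set0 (fun=> 0%N) (leqnn m) _).
- by rewrite ler_wpM2l ?mulr_ge0 // lerB.
- exact: (@choice_sum_le m cap s).
- by rewrite subrK.
- move=> j jm q.
  have qge : p - m%:R * x <= q by rewrite lerDl mulr_ge0.
  have qle : q <= p.
    by rewrite /q -lerBrDl opprB addrC subrK ler_wpM2r // ler_nat ltnW.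
  split; first exact: (@choice_quadratic_le1 m cap s).
  exact: (@choice_step_error_le m cap s).
- move=> v; rewrite muln0 leqn0 cards_eq0; apply/eqP/setP => u.
  by rewrite !inE.
Qed.

Lemma gnp_prob_packing_large :
  1 - N^-1 <= gnp_prob p (fun G : {set {set 'I_n}} =>
    [exists F : {set {set 'I_n}},
      edge_disjoint_cliques G k F && (t <= #|F|%:R :> R)]).
Proof.
have p01 : 0 <= p <= 1 by rewrite !ltW.
apply: le_trans (gnp_prob_packing p01 t0 mean_packing_large).
rewrite lerB // ler_pdivrMr ?exprn_gt0 // -ler_pdivrMl ?invr_gt0 // invrK.
have bin : 'C(n, 2)%:R <= N ^+ 2 / 2.
  rewrite ler_pdivlMr // -natrM -natrX ler_nat mulnC -mul_bin_diag bin1.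
  by rewrite leq_mul2l leq_pred orbT.
apply: (@le_trans _ _ (N * (64 * (N ^+ 2 / 2)))).
  by rewrite ler_wpM2l ?(ltW N0) // ler_wpM2l.
have -> : t ^+ 2 = N ^+ 3 * (p ^+ 2 * N * l ^+ 2 / (40 ^+ 2 * kr ^+ 8)).
  by rewrite /t; field; rewrite !lt0r_neq0.
have -> : N * (64 * (N ^+ 2 / 2)) = N ^+ 3 * 32 by field.
rewrite ler_wpM2l ?exprn_ge0 ?(ltW N0) // ler_pdivlMr ?mulr_gt0 ?exprn_gt0 //.
have h : 2 ^+ 16 * kr ^+ 8 <= p ^+ 2 * w by apply: base => //; rewrite d_le_pX.
have h2 : p ^+ 2 * w <= p ^+ 2 * N * l ^+ 2.
  rewrite -[leLHS]mulr1; apply: ler_pM;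
    rewrite ?mulr_ge0 ?exprn_ge0 ?(ltW hp0) ?(ltW w0) //.
    by rewrite ler_wpM2l ?exprn_ge0 ?(ltW hp0).
  by rewrite exprn_ege1 //; have := l2; lra.
have k8 : 0 <= kr ^+ 8 by rewrite exprn_ge0 // ltW.
by lra.
Qed.

End Constants.

(** * All conditions hold for large [n] *)

Lemma gnp_prob_packing_eventually (R : realType) (p : R) (C : nat) :
  0 < p -> p < 1 -> (4 <= C)%N ->
  exists B : R, forall n : nat, (0 < n)%N -> B <= ln n%:R ->
    1 - n%:R^-1 <= gnp_prob p (fun G : {set {set 'I_n}} =>
      [exists F : {set {set 'I_n}},
        edge_disjoint_cliques G (k0 n p - C) F &&
        (p * n%:R ^+ 2 * ln n%:R / (40 * (k0 n p - C)%:R ^+ 4) <= #|F|%:R :> R)]).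
Proof.
move=> hp0 hp1 C4.
pose L := - ln p; have L0 : 0 < L := oppr_ln_gt0 hp0 hp1.
pose a := 2 / L + 2; have a0 : 0 < a by rewrite addr_gt0 // divr_gt0.
pose d := p ^+ (10 + 3 * C) * (1 - p) ^+ 2.
have d0 : 0 < d by rewrite mulr_gt0 ?exprn_gt0 // subr_gt0.
(* Exponent [31] because [K ^ 30] is at most [(a * l) ^ 30]: one spare power of [l] remains to beat
   the constant [B1]. *)
have [fct fct0 expR_ge] : exists2 f : R, 0 < f &
    forall x : R, 0 <= x -> x ^+ 31 / f <= expR x.
  exists (31`!)%:R => [|x x0]; first by rewrite ltr0n fact_gt0.
  by apply: le_trans (expR_ge1Dxn 30 x0); rewrite lerDr.
pose B1 := 2 ^+ 20 * a ^+ 30 * (10 ^+ 31 * fct) / d.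
have B10 : 0 <= B1 by rewrite divr_ge0 ?(ltW d0) // !mulr_ge0 ?exprn_ge0 ?(ltW a0)
  ?(ltW fct0).
have CL : 0 <= C%:R * L by rewrite mulr_ge0 // ltW.
have LL : 0 <= L ^+ 2 by rewrite sqr_ge0.
(* [B1] serves [large]; [2 * (C * L)] gives [C < K] and [l <= L * k]; [L ^+ 2] gives [L <= k];
   [2 * L] gives [1 < k]. *)
exists (2 + B1 + 2 * (C%:R * L) + L ^+ 2 + 2 * L) => n n0 lB.
set l := ln n%:R in lB *; set K := k0 n p; set k := (K - C)%N.
have l2 : 2 <= l by lra.
have l0 : 0 < l by lra.
have nE : n%:R = expR l by rewrite lnK // posrE ltr0n.
pose w := expR (l / 10).
have K1 : 1 <= K%:R :> R by rewrite ler1n k0_gt0.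
have K0 : 0 < K%:R :> R by apply: lt_le_trans K1.
have Ka : K%:R <= a * l.
  rewrite -(ler_pM2r L0); apply: le_trans (k0_upper hp0 hp1 n0) _.
  have -> : a * l * L = 2 * l + 2 * L * l by rewrite /a; field; rewrite lt0r_neq0.
  by rewrite -/l -/L lerD2l ler_peMr ?mulr_ge0 ?(ltW L0) //; lra.
have large : 2 ^+ 20 * K%:R ^+ 30 <= d * w.
  have wl : (l / 10) ^+ 31 / fct <= w.
    by apply: expR_ge; rewrite divr_ge0 // ltW.
  apply: (@le_trans _ _ (d * ((l / 10) ^+ 31 / fct))); last first.
    by rewrite ler_wpM2l // ltW.
  apply: (@le_trans _ _ (2 ^+ 20 * (a * l) ^+ 30)).
    by rewrite ler_wpM2l ?exprn_ge0 // lerXn2r ?nnegrE ?mulr_ge0 ?(ltW a0) ?(ltW l0).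
  have -> : d * ((l / 10) ^+ 31 / fct) = l ^+ 30 * (d / (10 ^+ 31 * fct) * l).
    rewrite expr_div_n exprSr; field.
    by rewrite lt0r_neq0 //= expf_neq0.
  have -> : 2 ^+ 20 * (a * l) ^+ 30 = l ^+ 30 * (2 ^+ 20 * a ^+ 30).
    by rewrite exprMn mulrA mulrC.
  rewrite ler_wpM2l ?exprn_ge0 ?(ltW l0) //.
  have lB1 : B1 <= l by lra.
  apply: (@le_trans _ _ (d / (10 ^+ 31 * fct) * B1)).
    rewrite /B1 le_eqVlt; apply/orP; left; apply/eqP; field.
    by rewrite !lt0r_neq0 //= expf_neq0.
  by rewrite ler_wpM2l // divr_ge0 ?(ltW d0) // mulr_ge0 ?exprn_ge0 ?(ltW fct0).
have w1 : 1 <= w by apply: le_trans (expR_ge1Dx _); lra.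
have wn : w <= n%:R by rewrite nE ler_expR; lra.
have dpC : d <= p ^+ C.
  rewrite /d -[leRHS]mulr1; apply: ler_pM;
    rewrite ?exprn_ge0 ?(ltW hp0) ?subr_ge0 ?(ltW hp1) //.
    apply: ler_wiXn2l; rewrite ?(ltW hp0) ?(ltW hp1) //.
    by apply: leq_trans (leq_addl _ _); rewrite leq_pmull.
  by apply: exprn_ile1; lra.
have pC1 : p ^+ C <= 1 by apply: exprn_ile1; exact: ltW.
have large2 : (2 * K%:R) ^+ 2 <= p ^+ C * w.
  apply: le_trans (_ : d * w <= _); last by rewrite ler_wpM2r ?expR_ge0.
  apply: le_trans large; rewrite exprMn; apply: ler_pM; rewrite ?exprn_ge0 //.
    by rewrite ler_weXn2l // ler1n.
  by rewrite ler_weXn2l.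
have K2w : 2 * K%:R <= w.
  apply: le_trans (_ : (2 * K%:R) ^+ 2 <= _); first by rewrite expr2 ler_peMl //; lra.
  by apply: le_trans large2 _; rewrite ler_piMl ?expR_ge0.
have Kn : (2 * K <= n)%N by rewrite -(ler_nat R) natrM (le_trans K2w).
(* Logarithm of [k0_lower], whose right side is at most [w ^+ 2 = n ^ (1/5)]; so [9 / 5] is
   [2 - 1/5]. *)
have KL : 9 / 5 * l <= K.-1%:R * L.
  have h : expR (2 * l - K.-1%:R * L) <= expR (l / 5).
    have -> : expR (l / 5) = w ^+ 2 by rewrite /w -expRM_natl; congr expR; lra.
    apply: (@le_trans _ _ ((2 * K%:R) ^+ 2)).
      apply: le_trans (k0_lower hp0 hp1 Kn).
      by rewrite expRD expRM_natl -nE (expr_as_expR hp0).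
    by rewrite lerXn2r ?nnegrE ?mulr_ge0 ?expR_ge0.
  by move: h; rewrite ler_expR; lra.
have K1E : K.-1%:R = K%:R - 1 :> R.
  have Kpos : (0 < K)%N by exact: k0_gt0.
  by rewrite -[in RHS](prednK Kpos) -natr1 addrK.
rewrite K1E in KL.
have CK : (C < K)%N by rewrite -(ltr_nat R) -(ltr_pM2r L0); lra.
have kE : k%:R = K%:R - C%:R :> R by rewrite natrB // ltnW.
have lk : l <= L * k%:R by rewrite kE; lra.
have Lk : L <= k%:R by rewrite -(ler_pM2l L0); lra.
have k1 : (1 < k)%N by rewrite -(ltr_nat R) -(ltr_pM2l L0); lra.
have nu1 : 1 <= n%:R * p ^+ C / (2 * K%:R) ^+ 2.
  rewrite ler_pdivlMr ?exprn_gt0 ?mulr_gt0 // mul1r; apply: le_trans large2 _.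
  by rewrite mulrC ler_wpM2r ?exprn_ge0 ?(ltW hp0).
have mu_ge := expected_cliques_lower hp0 hp1 C4 CK Kn nu1.
apply: (@gnp_prob_packing_large R p l w K%:R C n k) => //.
by rewrite ler_nat leq_subr.
Qed.

Local Open Scope classical_set_scope.

Theorem theorem1p1 (R : realType) (p : R) (C : nat)
    (hp0 : 0 < p) (hp1 : p < 1) (hC : (4 <= C)%N) :
  (fun n : nat =>
     let k := (k0 n p - C)%N in
     gnp_prob p (fun G : {set {set 'I_n}} =>
       [exists F : {set {set 'I_n}},
          edge_disjoint_cliques G k F &&
          (p * n%:R ^+ 2 * ln n%:R / (40 * k%:R ^+ 4) <= #|F|%:R :> R)]))
    @ \oo --> (1 : R).
Proof.
have p01 : 0 <= p <= 1 by rewrite !ltW.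
have [B HB] := gnp_prob_packing_eventually hp0 hp1 hC.
apply/cvgrPdist_le => eps eps0.
exists (maxn (Num.truncn (expR B)).+1 (Num.truncn eps^-1).+1) => // n /=.
rewrite geq_max => /andP[nB neps].
have n0 : (0 < n)%N by apply: leq_trans nB.
have lB : B <= ln n%:R.
  rewrite -ler_expR lnK ?posrE ?ltr0n //.
  by apply: le_trans (ltW (truncnS_gt _)) _; rewrite ler_nat.
have neps' : n%:R^-1 <= eps.
  rewrite -[leRHS]invrK lef_pV2 ?posrE ?invr_gt0 ?ltr0n //.
  by apply: le_trans (ltW (truncnS_gt _)) _; rewrite ler_nat.
rewrite ger0_norm ?subr_ge0 ?gnp_prob_le1 // lerBlDl -lerBlDr.
by apply: le_trans (HB n n0 lB); rewrite lerB.
Qed.
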